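(* Let $G$ be an infinite finitely generated virtually free group. Then $k\text{-}\mathrm{SAT}(G)$ is decidable for all $k>1$.
   Context: A group is virtually free if it contains a finite index subgroup isomorphic to a free group. Let $S$ be a finite generating set of $G$; a word $w\in(S\cup S^{-1})^*$ evaluates to an element $\bar w\in G$. $k$-SAT over $G$ ($k>1$): Boolean variables are the elements of $G$; for $g\in G$, $g'$ denotes either the literal $g$ or its negation $\neg g$. An input formula is $\phi=\bigwedge_{i=1}^m (v_{i1}'\vee\dots\vee v_{ik}')$ with $v_{ij}\in (S\cup S^{-1})^*$, where each $'$ indicates a fixed choice of negated or non-negated; its evaluation is $\bar\phi=\bigwedge_{i=1}^m (\bar v_{i1}'\vee\dots\vee \bar v_{ik}')$. For $h\in G$, $\bar\phi(h)$ is obtained from $\bar\phi$ by left-multiplying every variable by $h$ (with the same negations). The problem $k\text{-}\mathrm{SAT}(G)$ is: given an input formula $\phi$ and words $w_1,\dots,w_n\in(S\cup S^{-1})^*$, determine whether $\bigwedge_{h\in H}\bar\phi(h)$ is satisfiable, where $H=\langle \bar w_1,\dots,\bar w_n\rangle$; that is, whether there is an assignment $\alpha:G\to\{0,1\}$ making every clause of $\bar\phi(h)$ true for every $h\in H$. (The choice of $S$ is immaterial, since inputs can be computably rewritten in another generating set.) *)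

(* Defs.v *)
From HB Require Import structures.
From mathcomp Require Import all_boot all_classical.

Set Implicit Arguments.
Unset Strict Implicit.
Unset Printing Implicit Defensive.

Local Open Scope classical_set_scope.
Local Open Scope group_scope.

(* The general recursive functions nat^n -> nat: minimization is applied only
   to functions that have a zero for every value of the parameters, so that
   all functions of the class are total.  By Kleene's normal form theorem
   these are exactly the total Turing-computable functions. *)
Inductive recursive : forall n : nat, (n.-tuple nat -> nat) -> Prop :=
| recursive_zero n : recursive (fun _ : n.-tuple nat => 0%N)
| recursive_succ : recursive (fun t : 1.-tuple nat => (thead t).+1)
| recursive_proj n (i : 'I_n) : recursive (fun t : n.-tuple nat => tnth t i)
| recursive_comp n m (f : m.-tuple nat -> nat) (g : 'I_m -> n.-tuple nat -> nat) :
    recursive f -> (forall i, recursive (g i)) ->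
    recursive (fun t : n.-tuple nat => f [tuple g i t | i < m])
| recursive_primrec n (f : n.-tuple nat -> nat) (g : n.+2.-tuple nat -> nat)
    (h : n.+1.-tuple nat -> nat) :
    recursive f -> recursive g ->
    (forall t : n.-tuple nat, h [tuple of 0%N :: t] = f t) ->
    (forall x (t : n.-tuple nat),
       h [tuple of x.+1 :: t] = g [tuple of x :: h [tuple of x :: t] :: t]) ->
    recursive h
| recursive_min n (f : n.+1.-tuple nat -> nat) (g : n.-tuple nat -> nat) :
    recursive f ->
    (forall t : n.-tuple nat, f [tuple of g t :: t] = 0%N) ->
    (forall (t : n.-tuple nat) y, (y < g t)%N -> f [tuple of y :: t] <> 0%N) ->
    recursive g.

(* Instances are given to the algorithm through the explicit numbering pickle;
   for the types of instances used below (sequences, tuples, pairs, booleans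
   and bounded integers) it is built from the bijection
   CodeSeq.code : seq nat -> nat. *)
Definition decidable_problem (T : countType) (P : T -> Prop) : Prop :=
  exists2 chi : 1.-tuple nat -> nat, recursive chi &
    forall x : T, chi [tuple pickle x] = `[< P x >] :> nat.

(* A letter (x, false) stands for x, and (x, true) for the inverse of x. *)
Definition eval_word (X : Type) (G : groupType) (s : X -> G)
    (w : seq (X * bool)) : G :=
  \prod_(a <- w) (if a.2 then (s a.1)^-1 else s a.1).

Section FreeGroup.
Variable X : choiceType.
Implicit Types (a b : X * bool) (u v w : seq (X * bool)).

Definition inv_letter a := (a.1, ~~ a.2).

Definition reduced w := sorted (fun a b => b != inv_letter a) w.

Definition push a w :=
  if w is b :: w' then if b == inv_letter a then w' else a :: w else [:: a].

Definition inv_word w := rev (map inv_letter w).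

Lemma inv_letterK : involutive inv_letter.
Proof. by case=> x b; rewrite /inv_letter /= negbK. Qed.

Lemma reduced_behead a w : reduced (a :: w) -> reduced w.
Proof. exact: path_sorted. Qed.

Lemma reduced_push a w : reduced w -> reduced (push a w).
Proof.
case: w => [//|b w] /= rw; case: ifPn => [_|nb]; first exact: path_sorted rw.
by rewrite /= nb.
Qed.

Lemma push_reduced a w : reduced (a :: w) -> push a w = a :: w.
Proof. by case: w => //= b w /andP[/negPf->]. Qed.

Lemma pushK a w : reduced w -> push (inv_letter a) (push a w) = w.
Proof.
case: w => [_|b w] /=; first by rewrite inv_letterK eqxx.
case: eqP => [-> rw|_ _]; first exact: push_reduced.
by rewrite /= inv_letterK eqxx.
Qed.

Lemma reduced_foldr u w : reduced w -> reduced (foldr push w u).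
Proof. by move=> rw; elim: u => //= a u; apply: reduced_push. Qed.

Lemma foldr_push_nil u : reduced u -> foldr push [::] u = u.
Proof.
elim: u => //= a u IHu ru; rewrite IHu; first exact: push_reduced.
exact: reduced_behead ru.
Qed.

Lemma foldr_push a u w : reduced u -> reduced w ->
  foldr push w (push a u) = push a (foldr push w u).
Proof.
case: u => [//|b u] ru rw /=; case: eqP => [->|_] //.
have := pushK (inv_letter a) (reduced_foldr u rw).
by rewrite inv_letterK => ->.
Qed.

Lemma foldr_pushA u v w : reduced v -> reduced w ->
  foldr push w (foldr push v u) = foldr push (foldr push w v) u.
Proof.
move=> rv rw; elim: u => //= a u IHu.
by rewrite foldr_push ?IHu //; apply: reduced_foldr.
Qed.

Lemma reduced_inv u : reduced u -> reduced (inv_word u).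
Proof.
rewrite /reduced /inv_word rev_sorted sorted_map; apply: sub_sorted => a b /=.
by rewrite inv_letterK; apply: contraNneq => ->.
Qed.

Lemma foldr_inv_word u : foldr push u (inv_word u) = [::].
Proof.
suff aux v : foldr push (u ++ v) (inv_word u) = v by rewrite -[u in foldr _ u]cats0 aux.
rewrite /inv_word; elim: u v => //= a u IHu v.
by rewrite rev_cons foldr_rcons /= inv_letterK eqxx IHu.
Qed.

(* The free group on X, as the set of reduced words on the letters x, x^-1. *)
Record free_group := FreeGroup {
  free_word :> seq (X * bool);
  free_wordP : reduced free_word }.

HB.instance Definition _ := [isSub for free_word].
HB.instance Definition _ := [Choice of free_group by <:].

Definition free_one : free_group := @FreeGroup [::] isT.
Definition free_mul (u v : free_group) : free_group :=
  FreeGroup (reduced_foldr u (free_wordP v)).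
Definition free_inv (u : free_group) : free_group :=
  FreeGroup (reduced_inv (free_wordP u)).

Lemma free_mulA : associative free_mul.
Proof.
move=> u v w; apply: val_inj => /=.
by rewrite foldr_pushA //; apply: free_wordP.
Qed.

Lemma free_mul1 : left_id free_one free_mul.
Proof. by move=> u; apply: val_inj. Qed.

Lemma free_mulr1 : right_id free_one free_mul.
Proof. by move=> u; apply: val_inj; apply/foldr_push_nil/free_wordP. Qed.

Lemma free_mulV : left_inverse free_one free_inv free_mul.
Proof. by move=> u; apply: val_inj; apply: foldr_inv_word. Qed.

Lemma free_invK : involutive free_inv.
Proof.
move=> u; apply: val_inj; rewrite /= /inv_word map_rev revK -map_comp.
by apply: map_id_in => a _; apply: inv_letterK.
Qed.

Lemma free_mulrV : right_inverse free_one free_inv free_mul.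
Proof. by move=> u; rewrite -[u in free_mul u _]free_invK free_mulV. Qed.

HB.instance Definition _ :=
  isGroup.Build free_group free_mulA free_mul1 free_mulr1 free_mulV free_mulrV.

End FreeGroup.

Definition subgroup (G : groupType) (H : set G) : Prop := group_closed (mem H).

Definition generated (G : groupType) (A : set G) : set G :=
  smallest (@subgroup G) A.

Definition left_coset (G : groupType) (H : set G) (g : G) : set G :=
  [set g * h | h in H].

Definition finite_index (G : groupType) (H : set G) : Prop :=
  finite_set (range (left_coset H)).

Definition is_free (G : groupType) (H : set G) : Prop :=
  exists (X : choiceType) (phi : {multiplicative free_group X -> G}),
    injective phi /\ range phi = H.

Definition virtually_free (G : groupType) : Prop :=
  exists H : set G, [/\ subgroup H, finite_index H & is_free H].

Definition generates (G : groupType) r (s : r.-tuple G) : Prop :=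
  generated [set` s] = [set: G].

Definition finitely_generated (G : groupType) : Prop :=
  exists (r : nat) (s : r.-tuple G), generates s.

(* A literal over V is a pair (v, b): v itself if b = false, its negation if
   b = true.  The empty conjunction is allowed as a formula. *)
Definition kcnf (V : Type) (k : nat) : Type := seq (k.-tuple (V * bool)).

Definition word (r : nat) : Type := seq ('I_r * bool).

(* The formula phi together with the generators w_1, ..., w_n of H. *)
Definition kSAT_input (r k : nat) : Type := (kcnf (word r) k * seq (word r))%type.

HB.instance Definition _ r k := Countable.on (kSAT_input r k).

Definition map_kcnf (V W : Type) (k : nat) (f : V -> W) (phi : kcnf V k) :
    kcnf W k :=
  [seq map_tuple (fun l => (f l.1, l.2)) c | c <- phi].

Definition satisfies (V : Type) (k : nat) (alpha : V -> bool) (phi : kcnf V k) :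
    bool :=
  all (fun c : k.-tuple (V * bool) => has (fun l => alpha l.1 (+) l.2) c) phi.

Section SAT.
Variables (G : groupType) (r : nat) (s : r.-tuple G) (k : nat).

Definition eval (w : word r) : G := eval_word (tnth s) w.

Definition translate (h : G) (phi : kcnf G k) : kcnf G k :=
  map_kcnf (fun g => h * g) phi.

Definition kSAT (x : kSAT_input r k) : Prop :=
  exists alpha : G -> bool,
    forall h, generated [set eval w | w in [set` x.2]] h ->
      satisfies alpha (translate h (map_kcnf eval x.1)).

End SAT.

Definition kSAT_decidable (G : groupType) (k : nat) : Prop :=
  forall (r : nat) (s : r.-tuple G), generates s -> decidable_problem (@kSAT G r s k).

(* Main.v *)
(* Let F be a free subgroup of finite index in G and T a finite right
   transversal of F.  The products t s^{+-1}, for t in T and s in S, are in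
   F_0 T where F_0 is generated by finitely many of the letters of F, so that
   normal forms in F_0 T = G can be computed.  A finite piece of the coset graph
   H\G, with edges labelled by these letters, is enough to recognize H: if it
   contains finitely many explicit paths, then every h in H is f t, where the
   reduced word f can be read in the piece from the coset H, and H f = H t^-1.
   The correctness of such a piece is certified by finitely many equalities of
   words, so that one can be found by an unbounded search.

   Given such a piece, choose a finite window B of G that is large enough for
   the clauses.  An assignment induces a set Q of pairs (H f, its restriction
   to f B), and these pairs satisfy the clauses and extend along every edge.
   Conversely, such a set Q, of which there are finitely many candidates,
   yields an assignment by extending patterns along the tree of the reduced
   words that can be read in the piece: the translates f B that contain a given
   element form a connected part of that tree, so that the patterns agree. *)

From HB Require Import structures.
Require Import Defs.
From mathcomp Require Import all_boot all_classical zify.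

Set Implicit Arguments.
Unset Strict Implicit.
Unset Printing Implicit Defensive.

(** * Recursive functions *)

Lemma eq_recursive n (f g : n.-tuple nat -> nat) :
  recursive f -> f =1 g -> recursive g.
Proof. by move=> rf /funext <-. Qed.

Definition recursive1 (f : nat -> nat) :=
  recursive (fun t : 1.-tuple nat => f (tnth t ord0)).

Definition recursive2 (f : nat -> nat -> nat) :=
  recursive (fun t : 2.-tuple nat => f (tnth t ord0) (tnth t (@Ordinal 2 1 isT))).

Section Composition.
Variable n : nat.
Implicit Types g h : n.-tuple nat -> nat.

Lemma recursive_app1 f g :
  recursive1 f -> recursive g -> recursive (fun t => f (g t)).
Proof.
move=> rf rg; apply: eq_recursive (recursive_comp rf (fun=> rg)) _ => t /=.
by rewrite tnth_mktuple.
Qed.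

Lemma recursive_app2 f g h : recursive2 f -> recursive g -> recursive h ->
  recursive (fun t => f (g t) (h t)).
Proof.
move=> rf rg rh.
have rgh (i : 'I_2) : recursive (if val i is 0 then g else h) by case: (val i).
by apply: eq_recursive (recursive_comp rf rgh) _ => t; rewrite !tnth_mktuple.
Qed.

Lemma recursive_cst c : recursive (fun _ : n.-tuple nat => c).
Proof.
elim: c => [|c IHc]; first exact: recursive_zero.
have rS : recursive1 S by apply: eq_recursive recursive_succ _ => t; rewrite /thead.
exact: recursive_app1 rS IHc.
Qed.

End Composition.

Lemma recursive_min2 (f : nat -> nat -> nat) (g : nat -> nat) :
  recursive2 f -> (forall a, f (g a) a = 0) ->
  (forall a y, y < g a -> f y a <> 0) -> recursive1 g.
Proof.
move=> rf f0 fmin; apply: recursive_min rf _ _ => t /= => [|y]; rewrite !(tnth_nth 0).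
  exact: f0.
exact: fmin.
Qed.

Lemma recursive_iter f : recursive1 f -> recursive2 (fun n a => iter n f a).
Proof.
move=> rf.
have rg : recursive (fun t : 3.-tuple nat => f (tnth t (@Ordinal 3 1 isT))).
  by apply: recursive_app1 rf _; apply: recursive_proj.
apply: (recursive_primrec (recursive_proj (@ord0 0)) rg) => [t|x t];
  by rewrite !(tnth_nth 0).
Qed.

Lemma recursive_succn : recursive1 succn.
Proof. by apply: eq_recursive recursive_succ _ => t; rewrite /thead. Qed.

Lemma recursive_addn : recursive2 addn.
Proof.
by apply: eq_recursive (recursive_iter recursive_succn) _ => t; rewrite iter_succn addnC.
Qed.

Lemma recursive_predn : recursive1 predn.
Proof.
have rg : recursive (fun t : 2.-tuple nat => tnth t ord0) by apply: recursive_proj.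
by apply: (recursive_primrec (recursive_zero 0) rg).
Qed.

Lemma recursive_subn : recursive2 subn.
Proof.
have r := recursive_app2 (recursive_iter recursive_predn) (recursive_proj (@Ordinal 2 1 isT))
  (recursive_proj (@ord0 1)).
apply: eq_recursive r _ => t; elim: (tnth t (Ordinal _)) => [|b IHb] /=.
  by rewrite subn0.
by rewrite IHb subnS.
Qed.

Lemma recursive_double : recursive1 double.
Proof.
apply: eq_recursive (recursive_app2 recursive_addn (recursive_proj ord0) (recursive_proj ord0)) _.
by move=> t /=; rewrite addnn.
Qed.

Lemma recursive_half : recursive1 half.
Proof.
(* [half c] is the least [n] with [c <= 2n + 1]. *)
pose f n c := c - n.*2.+1.
apply: (@recursive_min2 f) => [|a|a y]; rewrite /f; try lia.
apply: (recursive_app2 recursive_subn); first exact: recursive_proj.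
apply: (recursive_app1 recursive_succn).
by apply: (recursive_app1 recursive_double); exact: recursive_proj.
Qed.

Lemma recursive_odd : recursive1 (fun n => odd n : nat).
Proof.
have r := recursive_app2 recursive_subn (recursive_proj (@ord0 0))
 (recursive_app1 recursive_double (recursive_app1 recursive_half (recursive_proj (@ord0 0)))).
by apply: eq_recursive r _ => t /=; lia.
Qed.

(** * Codes of sequences of numbers *)

Definition consn n c := 2 ^ n * c.*2.+1.

Lemma recursive_consn : recursive2 consn.
Proof.
have r := recursive_app2 (recursive_iter recursive_double) (recursive_proj (@ord0 1))
  (recursive_app1 recursive_succn (recursive_app1 recursive_double
     (recursive_proj (@Ordinal 2 1 isT)))).
apply: eq_recursive r _ => t; rewrite /consn.
elim: (tnth t ord0) => [|n /= ->]; first by rewrite expn0 mul1n.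
by rewrite expnS -mul2n mulnA.
Qed.

Definition headn c := head 0 (CodeSeq.decode c).

Definition behead_code c := CodeSeq.code (behead (CodeSeq.decode c)).

Lemma headn_consn n c : headn (consn n c) = n.
Proof.
by rewrite /headn -[c]CodeSeq.decodeK -[consn _ _]/(CodeSeq.code (n :: _)) CodeSeq.codeK.
Qed.

Lemma behead_consn n c : behead_code (consn n c) = c.
Proof.
rewrite /behead_code -{1}[c]CodeSeq.decodeK -[consn _ _]/(CodeSeq.code (n :: _)).
by rewrite CodeSeq.codeK CodeSeq.decodeK.
Qed.

(** [consn n] maps the code of [s] to the code of [n :: s], and [CodeSeq.code] is onto: every number
    codes a sequence, and only 0 codes the empty one. *)
Lemma consn_spec c : c = 0 \/ c = consn (headn c) (behead_code c).
Proof.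
rewrite /headn /behead_code -{1 2}[c]CodeSeq.decodeK.
by case: (CodeSeq.decode c) => [|n s]; [left|right].
Qed.

Lemma iter_half_consn n m c : m <= n -> iter m half (consn n c) = consn (n - m) c.
Proof.
elim: m => [|m IHm] ltmn /=; first by rewrite subn0.
rewrite IHm 1?ltnW // /consn (_ : n - m = (n - m.+1).+1); last by lia.
by rewrite expnS -mulnA mul2n doubleK.
Qed.

Lemma odd_consn n c : odd (consn n c) = (n == 0).
Proof. by case: n => [|n]; rewrite /consn oddM oddX //= odd_double. Qed.

Lemma consn_gt0 n c : 0 < consn n c.
Proof. by rewrite muln_gt0 expn_gt0. Qed.

Lemma recursive_headn : recursive1 headn.
Proof.
(* The head of a nonzero code is its 2-adic valuation, the number of halvings before an odd number
   appears. For [c = 0] no odd number appears, and the vanishing of [1 - (1 - c)] stops the search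
   at the default head 0. *)
pose f n c := (1 - (1 - c)) - odd (iter n half c).
have rf : recursive2 f.
  apply: (recursive_app2 recursive_subn).
    apply: (recursive_app2 recursive_subn (recursive_cst _ 1)).
    by apply: (recursive_app2 recursive_subn (recursive_cst _ 1)); exact: recursive_proj.
  apply: (recursive_app1 recursive_odd).
  by apply: (recursive_app2 (recursive_iter recursive_half)); exact: recursive_proj.
apply: (recursive_min2 rf) => [c|c n] /=; rewrite /f.
  have [-> //|->] := consn_spec c; rewrite headn_consn iter_half_consn // odd_consn subnn eqxx.
  by lia.
have [->|->] := consn_spec c; first by rewrite [headn 0]/=.
rewrite headn_consn => ltn.
have := consn_gt0 (headn c) (behead_code c); rewrite (iter_half_consn _ (ltnW ltn)) odd_consn.
by lia.
Qed.

Lemma recursive_behead : recursive1 behead_code.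
Proof.
(* After [headn c] halvings [2d + 1] is left, where [d] codes the tail; one more halving gives
   [d]. *)
have r := recursive_app1 recursive_half (recursive_app2 (recursive_iter recursive_half)
  (recursive_app1 recursive_headn (recursive_proj (@ord0 0))) (recursive_proj (@ord0 0))).
apply: eq_recursive r _ => t /=.
have [->|->] := consn_spec (tnth t ord0); first by [].
rewrite headn_consn behead_consn iter_half_consn // subnn /consn expn0 mul1n.
by rewrite /= uphalf_double.
Qed.

Definition condn (b x y : nat) := if b is 0 then y else x.

(** The conditional is the entry of index [1 - b] in the code of the list of [x] and [y]. *)
Lemma recursive_condn n (b x y : n.-tuple nat -> nat) :
  recursive b -> recursive x -> recursive y ->
  recursive (fun t => condn (b t) (x t) (y t)).
Proof.
move=> rb rx ry.
have rb' := recursive_app2 recursive_subn (recursive_cst n 1) rb.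
have r := recursive_app1 recursive_headn (recursive_app2 (recursive_iter recursive_behead)
  rb' (recursive_app2 recursive_consn rx (recursive_app2 recursive_consn ry (recursive_cst n 0)))).
apply: eq_recursive r _ => t /=.
case: (b t) => [|c]; first by rewrite subn0 /= behead_consn headn_consn.
by rewrite subSS sub0n /= headn_consn.
Qed.

(** * Computable functions between countable types *)

Definition computable (A B : countType) (f : A -> B) : Prop :=
  exists2 F : nat -> nat, recursive1 F & forall a, F (pickle a) = pickle (f a).

Section Computable.
Variables A B C D : countType.

Lemma computable_id : computable (@id A).
Proof. by exists id => //; apply: recursive_proj. Qed.

Lemma computable_comp (f : A -> B) (g : B -> C) :
  computable g -> computable f -> computable (fun a => g (f a)).
Proof.
case=> G rG Gg [F rF Ff]; exists (fun n => G (F n)) => [|a]; last by rewrite Ff Gg.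
exact: recursive_app1 rG rF.
Qed.

Lemma computable_cst (b : B) : computable (fun _ : A => b).
Proof. by exists (fun=> pickle b) => //; apply: recursive_cst. Qed.

(** A pair is coded as the two-element list of the codes of its components. *)
Lemma computable_pair (f : A -> B) (g : A -> C) :
  computable f -> computable g -> computable (fun a => (f a, g a)).
Proof.
case=> F rF Ff [G rG Gg]; exists (fun n => consn (F n) (consn (G n) 0)) => [|a].
  apply: recursive_app2 recursive_consn rF _.
  exact: recursive_app2 recursive_consn rG (recursive_cst _ _).
by rewrite Ff Gg.
Qed.

Lemma computable_fst (f : A -> B * C) : computable f -> computable (fun a => (f a).1).
Proof.
case=> F rF Ff; exists (fun n => headn (F n)) => [|a].
  exact: recursive_app1 recursive_headn rF.
by rewrite Ff; case: (f a) => b c; rewrite headn_consn.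
Qed.

Lemma computable_snd (f : A -> B * C) : computable f -> computable (fun a => (f a).2).
Proof.
case=> F rF Ff; exists (fun n => headn (behead_code (F n))) => [|a].
  exact: recursive_app1 recursive_headn (recursive_app1 recursive_behead rF).
by rewrite Ff; case: (f a) => b c; rewrite behead_consn headn_consn.
Qed.

Lemma computable_pickle (f : A -> B) : computable f -> computable (fun a => pickle (f a)).
Proof. by case=> F rF Ff; exists F. Qed.

Lemma computable_tval k (f : A -> k.-tuple B) :
  computable f -> computable (fun a => tval (f a)).
Proof. by case=> F rF Ff; exists F. Qed.

Lemma computable_cons (f : A -> B) (g : A -> seq B) :
  computable f -> computable g -> computable (fun a => f a :: g a).
Proof.
case=> F rF Ff [G rG Gg]; exists (fun n => consn (F n) (G n)) => [|a].
  exact: recursive_app2 recursive_consn rF rG.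
by rewrite Ff Gg.
Qed.

Lemma computable_if (b : A -> bool) (f g : A -> B) :
  computable b -> computable f -> computable g ->
  computable (fun a => if b a then f a else g a).
Proof.
case=> N rN Nb [F rF Ff] [G rG Gg]; exists (fun n => condn (N n) (F n) (G n)) => [|a].
  exact: recursive_condn.
by rewrite Nb Ff Gg; case: (b a).
Qed.

(** As [pickle] is injective, two values agree when both truncated differences of their codes
    vanish; booleans are coded by 0 and 1. *)
Lemma computable_eq (f g : A -> B) :
  computable f -> computable g -> computable (fun a => f a == g a).
Proof.
case=> F rF Ff [G rG Gg]; exists (fun n => 1 - ((F n - G n) + (G n - F n))) => [|a].
  apply: recursive_app2 recursive_subn (recursive_cst _ _) _.
  apply: recursive_app2 recursive_addn _ _.
    exact: recursive_app2 recursive_subn rF rG.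
  exact: recursive_app2 recursive_subn rG rF.
rewrite Ff Gg -(inj_eq (pcan_inj pickleK)) -[pickle (_ == _)]/(_ == _ : nat).
by lia.
Qed.

Lemma computable_case (f : A -> B) (g : A -> C -> seq C -> B) (s : A -> seq C) :
  computable f -> computable (fun x : A * C * seq C => g x.1.1 x.1.2 x.2) ->
  computable s ->
  computable (fun a => if s a is x :: s' then g a x s' else f a).
Proof.
case=> F rF Ff [G rG Gg] [S rS Ss].
(* The code of [s a] is 0 exactly when [s a] is empty, so it serves as the test of [condn]; [H]
   assembles the code of the triple passed to [g]. *)
pose H n := G (consn (consn n (consn (headn (S n)) 0)) (consn (behead_code (S n)) 0)).
exists (fun n => condn (S n) (H n) (F n)) => [|a].
  apply: recursive_condn => //; apply: recursive_app1 rG _.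
  have rc n := recursive_cst n 0.
  apply: recursive_app2 recursive_consn _ _; last first.
    exact: recursive_app2 recursive_consn (recursive_app1 recursive_behead rS) (rc _).
  apply: recursive_app2 recursive_consn (recursive_proj _) _.
  exact: recursive_app2 recursive_consn (recursive_app1 recursive_headn rS) (rc _).
rewrite /H Ss Ff; case: (s a) => [|x s'] //.
rewrite -[pickle (x :: s')]/(consn (pickle x) (pickle s')) headn_consn behead_consn.
have := consn_gt0 (pickle x) (pickle s'); case: (consn _ _) => // _ _ /=.
exact: (Gg (a, x, s')).
Qed.

Lemma computable_iter (f : A -> B -> B) (b : A -> B) (n : A -> nat) :
  computable (fun x : A * B => f x.1 x.2) -> computable b -> computable n ->
  computable (fun a => iter (n a) (f a) (b a)).
Proof.
case=> F rF Ff [G rG Gg] [N rN Nn].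
(* [recursive_iter] iterates a function of one number, so the parameter [a] travels with the iterate
   in the code of a pair. *)
pose step m := consn (headn m) (consn (F m) 0).
have rstep : recursive1 step.
  apply: recursive_app2 recursive_consn (recursive_app1 recursive_headn (recursive_proj _)) _.
  exact: recursive_app2 recursive_consn rF (recursive_cst _ _).
exists (fun m => headn (behead_code (iter (N m) step (consn m (consn (G m) 0))))) => [|a].
  apply: recursive_app1 recursive_headn (recursive_app1 recursive_behead _).
  apply: recursive_app2 (recursive_iter rstep) rN _.
  apply: recursive_app2 recursive_consn (recursive_proj _) _.
  exact: recursive_app2 recursive_consn rG (recursive_cst _ _).
rewrite Nn Gg; set k := pickle (n a); have -> : k = n a by [].
suff -> : iter (n a) step (consn (pickle a) (consn (pickle (b a)) 0)) =
    pickle (a, iter (n a) (f a) (b a)).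
  by rewrite behead_consn headn_consn.
elim: {k} (n a) => //= k ->.
by rewrite /step (Ff (a, _)) headn_consn.
Qed.

End Computable.

Lemma eq_computable (A B : countType) (f g : A -> B) :
  computable f -> f =1 g -> computable g.
Proof. by move=> cf /funext <-. Qed.

Lemma computable_app2 (A B C D : countType) (g : B -> C -> D) (u : A -> B) (v : A -> C) :
  computable (fun x : B * C => g x.1 x.2) -> computable u -> computable v ->
  computable (fun a => g (u a) (v a)).
Proof.
move=> cg cu cv; apply: (computable_comp (f := fun a => (u a, v a)) cg).
exact: computable_pair.
Qed.

Lemma computable_app3 (A B C D E : countType) (g : B -> C -> D -> E)
    (u : A -> B) (v : A -> C) (w : A -> D) :
  computable (fun x : B * C * D => g x.1.1 x.1.2 x.2) ->
  computable u -> computable v -> computable w ->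
  computable (fun a => g (u a) (v a) (w a)).
Proof.
move=> cg cu cv cw; apply: (computable_comp (f := fun a => (u a, v a, w a)) cg).
by do 2?apply: computable_pair.
Qed.

Ltac computable_step :=
  match goal with
  | H : computable ?f |- computable ?f => exact: H
  | |- computable fst => exact: (computable_fst (computable_id _))
  | |- computable snd => exact: (computable_snd (computable_id _))
  | |- computable (fun x => x) => exact: computable_id
  | |- computable (fun=> ?c) => exact: computable_cst
  | |- computable (fun x => (_, _)) => apply: computable_pair
  | |- computable (fun x => fst _) => apply: computable_fst
  | |- computable (fun x => snd _) => apply: computable_snd
  | |- computable (fun x => tval _) => apply: computable_tval
  | |- computable (fun x => pickle _) => apply: computable_pickle
  | |- computable (fun x => _ :: _) => apply: computable_cons
  | |- computable (fun x => if _ then _ else _) => apply: computable_if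
  | |- computable (fun x => if _ is _ :: _ then _ else _) => apply: computable_case
  | |- computable (fun x => _ == _) => apply: computable_eq
  | H : computable ?f |- computable (fun x => ?f _) => apply: (computable_comp H)
  | H : computable (fun x => ?g (fst x) (snd x)) |- computable (fun a => ?g _ _) =>
    apply: (computable_app2 (g := g) H)
  | H : computable (fun x => ?g (fst (fst x)) (snd (fst x)) (snd x)) |-
      computable (fun a => ?g _ _ _) => apply: (computable_app3 (g := g) H)
  end.

Ltac computability := do ?computable_step.

(** * Computability of operations on lists *)

Lemma computable_foldl (A B C : countType) (g : A -> B -> C -> B) (b : A -> B) (s : A -> seq C) :
  computable (fun x : A * B * C => g x.1.1 x.1.2 x.2) ->
  computable b -> computable s ->
  computable (fun a => foldl (g a) (b a) (s a)).
Proof.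
move=> cg cb cs.
pose step a (sb : seq C * B) := if sb.1 is x :: s' then (s', g a sb.2 x) else sb.
have cstep : computable (fun x : A * (seq C * B) => step x.1 x.2).
  by rewrite /step; computability.
have ci : computable (fun a => (iter (pickle (s a)) (step a) (s a, b a)).2).
  by computable_step; apply: computable_iter; computability.
apply: eq_computable ci _ => a.
have le_size (l : seq C) : size l <= pickle l.
  elim: l => //= x l IHl; rewrite -[pickle _]/(consn (pickle x) (pickle l)) /consn.
  by have := expn_gt0 2 (pickle x); nia.
elim: (s a) (b a) (pickle (s a)) (le_size (s a)) => [|x l IHl] b0 n /=.
  by move=> _; suff -> : iter n (step a) ([::], b0) = ([::], b0) by []; elim: n => //= n ->.
by case: n => // n ltn; rewrite iterSr /= IHl.
Qed.

Lemma computable_catrev (A B : countType) (s t : A -> seq B) :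
  computable s -> computable t -> computable (fun a => catrev (s a) (t a)).
Proof.
move=> cs ct.
have cf : computable (fun a => foldl (fun l x => x :: l) (t a) (s a)).
  by apply: computable_foldl => //; computability.
by apply: eq_computable cf _ => a; elim: (s a) (t a) => //= x l IHl t0.
Qed.

Lemma computable_rev (A B : countType) (s : A -> seq B) :
  computable s -> computable (fun a => rev (s a)).
Proof. by move=> cs; apply: computable_catrev => //; computable_step. Qed.

Lemma computable_foldr (A B C : countType) (g : A -> C -> B -> B) (b : A -> B) (s : A -> seq C) :
  computable (fun x : A * C * B => g x.1.1 x.1.2 x.2) ->
  computable b -> computable s ->
  computable (fun a => foldr (g a) (b a) (s a)).
Proof.
move=> cg cb cs.
have cf : computable (fun a => foldl (fun y x => g a x y) (b a) (rev (s a))).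
  apply: computable_foldl => //; last exact: computable_rev.
  by computability.
by apply: eq_computable cf _ => a; rewrite foldl_rev.
Qed.

Lemma computable_map (A B C : countType) (f : A -> C -> B) (s : A -> seq C) :
  computable (fun x : A * C => f x.1 x.2) -> computable s ->
  computable (fun a => [seq f a x | x <- s a]).
Proof.
move=> cf cs.
have cr : computable (fun a => foldr (fun x l => f a x :: l) [::] (s a)).
  apply: computable_foldr => //; last by computable_step.
  by computability.
by apply: eq_computable cr _ => a; elim: (s a) => //= x l ->.
Qed.

Lemma computable_cat (A B : countType) (s t : A -> seq B) :
  computable s -> computable t -> computable (fun a => s a ++ t a).
Proof.
move=> cs ct; under eq_fun do rewrite -[X in X ++ _]revK -catrevE.
by apply: computable_catrev => //; apply: computable_rev.
Qed.

Lemma computable_filter (A C : countType) (p : A -> C -> bool) (s : A -> seq C) :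
  computable (fun x : A * C => p x.1 x.2) -> computable s ->
  computable (fun a => [seq x <- s a | p a x]).
Proof.
move=> cp cs.
have cr : computable (fun a => foldr (fun x l => if p a x then x :: l else l) [::] (s a)).
  apply: computable_foldr => //; last by computable_step.
  by computability.
by apply: eq_computable cr _ => a; elim: (s a) => //= x l ->.
Qed.

Lemma computable_has (A C : countType) (p : A -> C -> bool) (s : A -> seq C) :
  computable (fun x : A * C => p x.1 x.2) -> computable s ->
  computable (fun a => has (p a) (s a)).
Proof.
move=> cp cs.
have cr : computable (fun a => if [seq x <- s a | p a x] is _ :: _ then true else false).
  computability; exact: computable_filter.
by apply: eq_computable cr _ => a; rewrite has_filter; case: [seq _ <- _ | _].
Qed.

Section Booleans.
Variable A : countType.
Implicit Types f g : A -> bool.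

Lemma computable_and f g :
  computable f -> computable g -> computable (fun a => f a && g a).
Proof. by move=> cf cg; apply: computable_if => //; computable_step. Qed.

Lemma computable_implb f g :
  computable f -> computable g -> computable (fun a => f a ==> g a).
Proof. by move=> cf cg; apply: computable_if => //; computable_step. Qed.

Lemma computable_negb f : computable f -> computable (fun a => ~~ f a).
Proof. by move=> cf; apply: computable_if => //; computable_step. Qed.

Lemma computable_addb f g :
  computable f -> computable g -> computable (fun a => f a (+) g a).
Proof.
move=> cf cg; apply: eq_computable (computable_if cf (computable_negb cg) cg) _ => a.
by case: (f a).
Qed.

End Booleans.

Lemma computable_all (A C : countType) (p : A -> C -> bool) (s : A -> seq C) :
  computable (fun x : A * C => p x.1 x.2) -> computable s ->
  computable (fun a => all (p a) (s a)).
Proof.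
move=> cp cs.
have cr : computable (fun a => ~~ has (fun x => ~~ p a x) (s a)).
  apply: computable_negb; apply: computable_has => //; exact: computable_negb.
by apply: eq_computable cr _ => a; rewrite has_predC negbK.
Qed.

Lemma computable_mem (A C : countType) (f : A -> C) (s : A -> seq C) :
  computable f -> computable s -> computable (fun a => f a \in s a).
Proof.
move=> cf cs.
have cr : computable (fun a => has (fun y => y == f a) (s a)).
  by apply: computable_has => //; computability.
by apply: eq_computable cr _ => a; rewrite has_pred1.
Qed.

Lemma computable_flatten (A C : countType) (s : A -> seq (seq C)) :
  computable s -> computable (fun a => flatten (s a)).
Proof.
move=> cs; apply: (computable_foldr (g := fun=> @cat C)) => //; last by computable_step.
by apply: computable_cat; computability.
Qed.

Lemma computable_size (A C : countType) (s : A -> seq C) :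
  computable s -> computable (fun a => size (s a)).
Proof.
move=> cs; have cr : computable (fun a => foldr (fun _ n => n.+1) 0 (s a)).
  apply: computable_foldr => //; last by computable_step.
  have cS : computable succn by exists succn => //; apply: recursive_succn.
  by computability.
by apply: eq_computable cr _ => a; elim: (s a) => //= x l ->.
Qed.

Lemma computable_allpairs (A B C D : countType) (f : A -> B -> C -> D)
    (s : A -> seq B) (t : A -> seq C) :
  computable (fun x : A * B * C => f x.1.1 x.1.2 x.2) ->
  computable s -> computable t ->
  computable (fun a => [seq f a x y | x <- s a, y <- t a]).
Proof.
move=> cf cs ct; apply: computable_flatten; apply: computable_map => //.
by apply: computable_map => //; computability.
Qed.

Fixpoint subseqs (T : Type) (s : seq T) : seq (seq T) :=
  if s is x :: s' then subseqs s' ++ [seq x :: t | t <- subseqs s'] else [:: [::]].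

(** The sets sought later, patterns and sets of pairs alike, are given by a predicate on a known
    list, so it is enough that [subseqs] contains all filters. *)
Lemma filter_subseqs (T : eqType) (p : pred T) (s : seq T) : [seq x <- s | p x] \in subseqs s.
Proof.
elim: s => //= x s IHs; rewrite mem_cat; case: ifP => _; last by rewrite IHs.
by rewrite map_f ?orbT.
Qed.

Lemma computable_subseqs (A B : countType) (s : A -> seq B) :
  computable s -> computable (fun a => subseqs (s a)).
Proof.
move=> cs.
have cr : computable (fun a =>
    foldr (fun x l => l ++ [seq x :: t | t <- l]) [:: [::]] (s a)).
  apply: computable_foldr => //; last by computable_step.
  apply: computable_cat; first by computability.
  by apply: (computable_map (f := fun x => cons x.1.2)); computability.
by apply: eq_computable cr _ => a; elim: (s a) => //= x l ->.
Qed.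

Ltac computable_list_step :=
  match goal with
  | |- computable (fun x => _ && _) => apply: computable_and
  | |- computable (fun x => _ ==> _) => apply: computable_implb
  | |- computable (fun x => ~~ _) => apply: computable_negb
  | |- computable (fun x => _ (+) _) => apply: computable_addb
  | |- computable (fun x => has _ _) => apply: computable_has
  | |- computable (fun x => all _ _) => apply: computable_all
  | |- computable (fun x => map _ _) => apply: computable_map
  | |- computable (fun x => seq.filter _ _) => apply: computable_filter
  | |- computable (fun x => flatten _) => apply: computable_flatten
  | |- computable (fun x => foldl _ _ _) => apply: computable_foldl
  | |- computable (fun x => cat _ _) => apply: computable_cat
  | |- computable (fun x => rev _) => apply: computable_rev
  | |- computable (fun x => subseqs _) => apply: computable_subseqs
  | |- computable (fun x => in_mem _ _) => apply: computable_mem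
  end.

(** * Finite types, decoding and unbounded search *)

Lemma computable_finite (T : finType) (B : countType) (f : T -> B) : computable f.
Proof.
case: (pickP T) => [x0 _|T0]; last first.
  by exists (fun=> 0) => [|a]; [apply: recursive_cst|have := T0 a].
(* The table of values of [f] is a constant list; the default [f x0] is never returned, since
   [enum T] contains every [a]. *)
have cr : computable (fun a => foldr (fun x b => if x.1 == a then x.2 else b) (f x0)
    [seq (x, f x) | x <- enum T]).
  apply: computable_foldr; try by computable_step.
  by computability.
apply: eq_computable cr _ => a; have : a \in enum T by rewrite mem_enum.
by elim: (enum T) => //= x l IHl; rewrite inE eq_sym; case: eqP => /= [->|].
Qed.

(** A computable left inverse of [pickle], with singletons for values. Numbers that are not codes
    may give any list, even one with several elements. *)
Definition decodable (A : countType) : Prop :=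
  exists2 D : nat -> seq A, computable D & forall a, D (pickle a) = [:: a].

Lemma computable_decode : computable CodeSeq.decode.
Proof.
exists id => [|n]; first exact: recursive_proj.
rewrite -[RHS]/(CodeSeq.code (map id _)) map_id.
by rewrite CodeSeq.decodeK.
Qed.

Lemma decodable_finite (T : finType) : decodable T.
Proof.
exists (fun n => [seq x <- enum T | pickle x == n]) => [|a].
  by apply: computable_filter; computability.
under eq_filter do rewrite (inj_eq (pcan_inj pickleK)).
rewrite filter_pred1_uniq ?enum_uniq //.
by rewrite mem_enum.
Qed.

Lemma decodable_seq (A : countType) : decodable A -> decodable (seq A).
Proof.
case=> D cD Da; exists (fun n => [:: flatten [seq D m | m <- CodeSeq.decode n]]) => [|s].
  computable_step; last by computable_step.
  apply: computable_flatten; apply: computable_map; computability.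
  exact: computable_decode.
rewrite CodeSeq.codeK; congr [:: _]; elim: s => //= x s ->.
by rewrite Da.
Qed.

Lemma decodable_pair (A B : countType) :
  decodable A -> decodable B -> decodable (A * B)%type.
Proof.
case=> DA cDA DAa [DB cDB DBb].
exists (fun n => if CodeSeq.decode n is i :: s then
    if s is j :: _ then [seq (a, b) | a <- DA i, b <- DB j] else [::] else [::]) => [|[a b]].
  apply: computable_case; [by computable_step| |exact: computable_decode].
  apply: computable_case; [by computable_step| |by computability].
  by apply: computable_allpairs; computability.
by rewrite CodeSeq.codeK DAa DBb.
Qed.

Lemma decodable_tuple (A : countType) k : decodable A -> decodable (k.-tuple A).
Proof.
move=> /decodable_seq[D cD Ds].
exists (fun n => pmap insub (D n)) => [|s]; last first.
  by rewrite -[pickle s]/(pickle (tval s)) Ds /= valK.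
have: computable (fun n => [seq s <- D n | size s == k]).
  apply: computable_filter => //; computability.
  by apply: computable_size; computable_step.
(* A tuple has the same code as its sequence, so the function that selects the sequences of size [k]
   also computes [pmap insub]. *)
case=> F rF Fn; exists F => // n; rewrite Fn; congr CodeSeq.code.
by elim: (D n) => //= s l IHl; case: insubP => [t -> st|/negPf->] //=; rewrite IHl -st.
Qed.

(* Unbounded search: the witness is found by minimization, which has to
   succeed also on the numbers that are not codes of an [A]. *)
Lemma decidable_search (A C : countType) (check answer : A * C -> bool) (P : A -> Prop) :
  decodable A -> decodable C -> computable check -> computable answer ->
  (forall a, exists c, check (a, c)) ->
  (forall a c, check (a, c) -> reflect (P a) (answer (a, c))) ->
  decidable_problem P.
Proof.
case=> DA cDA DAa [DC cDC DCc] ccheck canswer check_ex answerP.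
(* A number that is not a code may decode to several instances without a common certificate;
   [take 1] keeps at most one, so that the search always ends. *)
pose found (x : nat * nat) :=
  all (fun a => has (fun c => check (a, c)) (DC x.1)) (take 1 (DA x.2)).
have cfound : computable found.
  apply: computable_all; last first.
    have -> : (fun x : nat * nat => take 1 (DA x.2)) =
              (fun x => if DA x.2 is a :: _ then [:: a] else [::]).
      by apply/funext => x; case: (DA x.2) => // a l; rewrite /= take0.
    by computability.
  by apply: computable_has; computability.
have ex_found n : exists y, found (y, n).
  rewrite /found /=; case: (DA n) => [|a l]; first by exists 0.
  by have [c ac] := check_ex a; exists (pickle c); rewrite /= take0 DCc /= ac.
pose g n := ex_minn (ex_found n).
have gP n : found (g n, n) by rewrite /g; case: ex_minnP.
have gmin n y : y < g n -> found (y, n) = false.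
  by rewrite /g; case: ex_minnP => m _ le_m; apply: contraTF => /le_m; rewrite leqNgt.
have rg : recursive1 g.
  have [F rF Ff] := cfound.
  have Fe y n : F (consn y (consn n 0)) = found (y, n) := Ff (y, n).
  apply: (@recursive_min2 (fun y n => 1 - F (consn y (consn n 0)))) => [|n|n y ltyg].
  - apply: recursive_app2 recursive_subn (recursive_cst _ _) _.
    apply: recursive_app1 rF _.
    apply: recursive_app2 recursive_consn (recursive_proj _) _.
    exact: recursive_app2 recursive_consn (recursive_proj _) (recursive_cst _ _).
  - by rewrite Fe gP.
  - by rewrite Fe gmin.
have cg : computable (fun a : A => g (pickle a)) by exists g.
pose chi a := has (fun c => check (a, c) && answer (a, c)) (DC (g (pickle a))).
have cchi : computable chi.
  apply: computable_has; first by apply: computable_and; computability.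
  by apply: computable_comp cDC cg.
have [F rF Ff] := cchi.
exists (fun t => F (tnth t ord0)) => // a; rewrite [tnth _ _]/= Ff.
rewrite -[pickle _]/(chi a : nat); congr nat_of_bool; apply/idP/asboolP.
  by case/hasP => c _ /andP[/answerP H /H].
move=> Pa; have := gP (pickle a); rewrite /found DAa /= andbT => /hasP[c cD ac].
by apply/hasP; exists c => //; rewrite ac; apply/answerP.
Qed.

(** * Words, generated subgroups and free groups *)

Local Open Scope group_scope.

Section EvalWord.
Variables (G : groupType) (Y : Type) (h : Y -> G).
Implicit Types (a : Y * bool) (w : seq (Y * bool)).

Lemma eval_word_nil : eval_word h [::] = 1.
Proof. exact: big_nil. Qed.

Lemma eval_word_cat w w' : eval_word h (w ++ w') = eval_word h w * eval_word h w'.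
Proof. exact: big_cat. Qed.

Lemma eval_word_cons a w : eval_word h (a :: w) = eval_word h [:: a] * eval_word h w.
Proof. exact: (eval_word_cat [:: a]). Qed.

Lemma eval_word_rcons a w : eval_word h (rcons w a) = eval_word h w * eval_word h [:: a].
Proof. by rewrite -cats1 eval_word_cat. Qed.

Lemma eval_word_inv_letter a : eval_word h [:: (a.1, ~~ a.2)] = (eval_word h [:: a])^-1.
Proof. by rewrite /eval_word !big_seq1 /=; case: a.2; rewrite //= invgK. Qed.

Lemma eval_word_inv w :
  eval_word h (rev [seq (a.1, ~~ a.2) | a <- w]) = (eval_word h w)^-1.
Proof.
elim: w => [|a w IHw]; first by rewrite eval_word_nil invg1.
rewrite eval_word_cons /= rev_cons eval_word_rcons IHw eval_word_inv_letter.
by rewrite invgM.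
Qed.

End EvalWord.

Section Eval.
Variables (G : groupType) (r : nat) (s : r.-tuple G).

Lemma eval_nil : eval s [::] = 1.
Proof. exact: eval_word_nil. Qed.

Lemma eval_cat w w' : eval s (w ++ w') = eval s w * eval s w'.
Proof. exact: eval_word_cat. Qed.

Lemma eval_inv w : eval s (inv_word w) = (eval s w)^-1.
Proof. exact: eval_word_inv. Qed.

End Eval.

Definition symmetric_closure r (ws : seq (word r)) :=
  ws ++ [seq inv_word w | w <- ws].

Lemma inv_symmetric_closure r (ws : seq (word r)) w :
  w \in symmetric_closure ws -> inv_word w \in symmetric_closure ws.
Proof.
rewrite !mem_cat => /orP[ws_w|/mapP[v ws_v ->]]; first by rewrite map_f ?orbT.
suff -> : inv_word (inv_word v) = v by rewrite ws_v.
by rewrite /inv_word map_rev revK -map_comp map_id_in // => a _; apply: inv_letterK.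
Qed.

Lemma subgroup_generated (G : groupType) (A : set G) : subgroup (generated A).
Proof.
split=> [|g h /set_mem Ag /set_mem Ah]; apply/mem_set => S [[S1 SV] AS].
  exact/set_mem.
apply/set_mem/SV; apply/mem_set; [exact: Ag|exact: Ah].
Qed.

Section Generated.
Variables (G : groupType) (r : nat) (s : r.-tuple G) (ws : seq (word r)).
Local Notation H := (generated [set eval s w | w in [set` ws]]%classic).

(** The factorization [vs] is a finite witness of membership in [H], of the kind that transitions
    and labels record. *)
Definition spelled g := exists2 vs, all (mem (symmetric_closure ws)) vs &
  eval s (flatten vs) = g.

Lemma generatedP g : H g <-> spelled g.
Proof.
split=> [Hg|[vs ws_vs <-]].
  apply: Hg; split=> [|h [w /= ws_w <-]]; last first.
    exists [:: w]; rewrite /= ?cats0 // andbT mem_cat.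
    by rewrite ws_w.
  split=> [|h1 h2 /set_mem[v1 ws1 <-] /set_mem[v2 ws2 <-]]; apply/mem_set.
    by exists [::] => //; apply: eval_nil.
  exists (v1 ++ rev [seq inv_word v | v <- v2]).
    rewrite all_cat ws1 /= all_rev all_map; apply/allP => v /(allP ws2).
    exact: inv_symmetric_closure.
  rewrite flatten_cat eval_cat; congr (_ * _).
  elim: v2 {ws2} => [|v v2 IHv]; first by rewrite /= eval_nil invg1.
  rewrite /= rev_cons -cats1 flatten_cat eval_cat IHv.
  by rewrite /= cats0 eval_inv eval_cat invgM.
have [H1 HV] : subgroup H by apply: subgroup_generated.
have HMV g1 h : H g1 -> H h -> H (g1 * h^-1).
  by move=> Hg Hh; apply/set_mem/HV; apply/mem_set.
have H1' : H 1 by apply/set_mem.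
have HI h : H h -> H h^-1 by move=> /(HMV _ _ H1'); rewrite mul1g.
elim: vs ws_vs => [|v vs IHvs] /=; first by move=> _; rewrite eval_nil.
case/andP=> ws_v /IHvs Hvs; rewrite eval_cat -[eval s (flatten vs)]invgK.
apply: HMV; last exact: HI.
have Hws w : w \in ws -> H (eval s w) by move=> ws_w S [_ sub]; apply: sub; exists w.
move: ws_v; rewrite mem_cat => /orP[/Hws //|/mapP[w /Hws Hw ->]].
by rewrite eval_inv; apply: HI.
Qed.

Lemma spelled1 : spelled 1.
Proof. by exists [::]; rewrite // eval_nil. Qed.

Lemma spelledM g h : spelled g -> spelled h -> spelled (g * h).
Proof.
move=> [u ws_u <-] [v ws_v <-]; exists (u ++ v); first by rewrite all_cat ws_u.
by rewrite flatten_cat eval_cat.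
Qed.

Lemma spelledV g : spelled g -> spelled g^-1.
Proof.
rewrite -!generatedP => wsg.
have [H1 HV] := subgroup_generated [set eval s w | w in [set` ws]]%classic.
by rewrite -[_^-1]mul1g; apply/set_mem/HV => //; apply/mem_set.
Qed.

End Generated.

Lemma eval_word_surj (G : groupType) r (s : r.-tuple G) :
  generates s -> forall g, exists w, eval s w = g.
Proof.
move=> gen_s g; have : generated [set` s]%classic g by rewrite gen_s.
pose ws : seq (word r) := [seq [:: (i, false)] | i <- enum 'I_r].
move=> sg; have : generated [set eval s w | w in [set` ws]]%classic g.
  move=> S [subS wsS]; apply: sg; split=> // _ /tnthP[i ->]; apply: wsS.
  exists [:: (i, false)]; first by apply: map_f; rewrite mem_enum.
  exact: big_seq1.
by case/generatedP=> vs _ <-; exists (flatten vs).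
Qed.

Lemma right_transversal (G : groupType) (H : set G) : subgroup H -> finite_index H ->
  exists (J : finType) (j0 : J) (T : J -> G), [/\ T j0 = 1,
    forall g, exists2 h, H h & exists j, g = h * T j &
    forall h h' j j', H h -> H h' -> h * T j = h' * T j' -> j = j'].
Proof.
move=> [/set_mem H1 HB] finH.
have HV h h' : H h -> H h' -> H (h * h'^-1).
  by move=> Hh Hh'; apply/set_mem/HB; apply/mem_set.
have HI h : H h -> H h^-1 by move=> /(HV _ _ H1); rewrite mul1g.
have HM h h' : H h -> H h' -> H (h * h') by move=> Hh /HI/(HV _ _ Hh); rewrite invgK.
(* One element is chosen in each left coset, namely 1 in [H] itself; the inverses of these elements
   form a right transversal. *)
pose rep (C : set G) : G := if `[< C 1 >] then 1 else xget 1 C.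
have repP g : H (g^-1 * rep (left_coset H g)).
  suff [h Hh <-] : left_coset H g (rep (left_coset H g)) by rewrite mulKg.
  by rewrite /rep; case: asboolP => // _; apply: xgetPex; exists (g * 1), 1.
have rep_eq g g' : H (g^-1 * g') -> left_coset H g = left_coset H g'.
  move=> Hgg'; apply/seteqP; split=> _ [h Hh <-].
    exists (g'^-1 * g * h); last by rewrite !mulgA mulgV mul1g.
    by apply: HM => //; rewrite -[g'^-1 * g]invgK invgM invgK; apply: HI.
  by exists (g^-1 * g' * h); [apply: HM|rewrite !mulgA mulgV mul1g].
have [R defR] : exists R : seq G,
    [set rep C | C in range (left_coset H)]%classic = [set` R]%classic.
  by apply/finite_seqP/finite_image.
have Rrep g : rep (left_coset H g) \in R.
  have : [set` R]%classic (rep (left_coset H g)) by rewrite -defR; do 2?eexists.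
  by [].
have R1 : 1 \in R.
  have := Rrep 1; rewrite /rep asboolT //.
  by exists 1; rewrite ?mulg1.
exists (seq_sub R), (SeqSub R1), (fun j => (ssval j)^-1); split=> /=.
- exact: invg1.
- move=> g; exists (g * rep (left_coset H g^-1)); first by have := repP g^-1; rewrite invgK.
  by exists (SeqSub (Rrep g^-1)); rewrite /= mulgK.
- move=> h h' [x Rx] [y Ry] Hh Hh' /= e; apply: val_inj => /=.
  have xE z : z \in R -> rep (left_coset H z) = z.
    move=> Rz; have : [set` R]%classic z by [].
    rewrite -defR => -[_ [g _ <-] <-]; congr rep; apply/esym/rep_eq; exact: repP.
  rewrite -(xE x) // -(xE y) //; congr rep; apply: rep_eq.
  suff -> : x^-1 * y = h^-1 * h' by apply: HM => //; apply: HI.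
  by apply: (canLR (mulgVK _)); rewrite -mulgA -e mulKg.
Qed.

Lemma eval_free_word (Y : choiceType) (G : groupType)
    (phi : {multiplicative free_group Y -> G}) (u : free_group Y) :
  phi u = eval_word (fun y => phi (@FreeGroup Y [:: (y, false)] isT)) u.
Proof.
have phi1 : phi 1 = 1 by apply: (@mulgI _ (phi 1)); rewrite -gmulfM !mulg1.
have phiV v : phi v^-1 = (phi v)^-1.
  by apply: (@mulgI _ (phi v)); rewrite -gmulfM !mulgV.
case: u => w rw /=; elim: w rw => [|[y b] w IHw] rw.
  have -> : FreeGroup rw = 1 by apply: val_inj.
  by rewrite eval_word_nil.
have rw' := reduced_behead rw.
have -> : FreeGroup rw = (@FreeGroup Y [:: (y, b)] isT) * FreeGroup rw'.
  by apply: val_inj; rewrite /= push_reduced.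
rewrite gmulfM IHw [RHS]eval_word_cons; congr (_ * _).
rewrite /eval_word big_seq1 /=; case: b {rw} => //.
by rewrite -phiV; apply: (congr1 phi); apply: val_inj.
Qed.

Lemma reduced_rev (X : choiceType) (y : seq (X * bool)) : reduced y -> reduced (rev y).
Proof.
rewrite /reduced rev_sorted; apply: sub_sorted => a b.
by apply: contraNneq => ->; rewrite inv_letterK.
Qed.

Lemma reduced_catrev (X : choiceType) (a : X * bool) y l :
  reduced (a :: y) -> reduced (a :: l) -> reduced (catrev y (a :: l)).
Proof.
elim: y a l => //= b y IHy a l /andP[ab rby] ral; apply: IHy => //=.
rewrite ral andbT; apply: contraNneq ab => ->; by rewrite inv_letterK.
Qed.

Lemma satisfies_map (V W : Type) k (alpha : W -> bool) (f : V -> W) (phi : kcnf V k) :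
  satisfies alpha (map_kcnf f phi) =
  all (fun c : k.-tuple (V * bool) => has (fun l => alpha (f l.1) (+) l.2) (tval c)) phi.
Proof. by rewrite /satisfies all_map; apply: eq_all => c /=; rewrite has_map. Qed.

Lemma ohead_filter (A : eqType) (f : pred A) (t : seq A) x :
  ohead [seq y <- t | f y] = Some x -> f x /\ x \in t.
Proof.
move=> e; apply/andP; rewrite -mem_filter.
by case: [seq y <- t | f y] e => //= y t' [->]; rewrite mem_head.
Qed.

Lemma ohead_has (A : eqType) (f : pred A) (t : seq A) :
  has f t -> exists x, ohead [seq y <- t | f y] = Some x.
Proof. by rewrite has_filter; case: [seq _ <- _ | _] => // x t' _; exists x. Qed.

(** * The decision procedure *)

Section Algorithm.
Variables (X J : finType) (r : nat) (j0 : J).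
(** [table (j, a)] is meant to be the normal form of [T j] times the letter [a]. This map and the
    next two have finite domains, hence are computable whatever their values. *)
Variable table : J * ('I_r * bool) -> seq (X * bool) * J.
Variables (letter_word : X * bool -> word r) (coset_word : J -> word r).

(* The normal form f T_j is the pair (f, j), but in products f is a stack whose
   top is its last letter. *)
Definition mul_gen (g : seq (X * bool) * J) (a : 'I_r * bool) :=
  (foldl (fun l x => push x l) g.1 (table (g.2, a)).1, (table (g.2, a)).2).

Definition mul_word g (w : word r) := foldl mul_gen g w.

Definition same_value (w w' : word r) :=
  mul_word ([::], j0) w == mul_word ([::], j0) w'.

Definition normal_form j (w : word r) :=
  (rev (mul_word ([::], j) w).1, (mul_word ([::], j) w).2).

(* A word u stands for the coset H u.  The transition (u, x, v, g) asserts that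
   u x = g v, and the label (u, j, g) that u T_j = g, where g is a product of
   generators of H and of their inverses. *)
Definition transition : Type := (word r * (X * bool) * word r * seq (word r))%type.
Definition label : Type := (word r * J * seq (word r))%type.
(* Finite sets of normal forms; a subset of a window is a pattern, namely the
   set of the variables which are true. *)
Definition window : Type := seq (seq (X * bool) * J).
Definition certificate : Type := (seq transition * seq label * window)%type.

HB.instance Definition _ := Countable.on transition.
HB.instance Definition _ := Countable.on label.
HB.instance Definition _ := Countable.on window.
HB.instance Definition _ := Countable.on certificate.

Implicit Types (E : seq transition) (N : seq label) (B p : window).

Definition delta E u a := [seq e.1.2 | e <- [seq e <- E | e.1.1 == (u, a)]].

Definition reach E u (c : seq (X * bool)) :=
  foldl (fun us a => flatten [seq delta E v a | v <- us]) [:: u] c.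

Definition labelled N u j := (u, j) \in [seq n.1 | n <- N].

Definition deterministic E :=
  all (fun e => all (fun u => u == e.1.2) (delta E e.1.1.1 e.1.1.2)) E.

Definition invertible E :=
  all (fun e => e.1.1.1 \in delta E e.1.2 (inv_letter e.1.1.2)) E.

(** Consider the elements f T_j such that f can be read from the base state and ends at a state
    labelled [j]. The condition makes this set contain 1 and be stable under right multiplication by
    the generators, so it contains [H]. *)
Definition closed_labels (ws : seq (word r)) E N :=
  labelled N [::] j0 &&
  all (fun n => all (fun w =>
    has (fun u => labelled N u (normal_form n.1.2 w).2)
        (reach E n.1.1 (normal_form n.1.2 w).1)) (symmetric_closure ws)) N.

Definition witnessed (ws : seq (word r)) E N :=
  all (fun e => all (fun w => w \in symmetric_closure ws) e.2 &&
    same_value (e.1.1.1 ++ letter_word e.1.1.2) (flatten e.2 ++ e.1.2)) E &&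
  all (fun n => all (fun w => w \in symmetric_closure ws) n.2 &&
    same_value (n.1.1 ++ coset_word n.1.2) (flatten n.2)) N.

(** Dropping first letters lets an element f y T_j be followed through the windows along y. All [j]
    occur because h = f T_j turns the variable h v into f (T_j v). *)
Definition closed_window k (phi : kcnf (word r) k) B :=
  all (fun b => if b.1 is _ :: y then (y, b.2) \in B else true) B &&
  all (fun c : k.-tuple (word r * bool) => all (fun l =>
    all (fun j => normal_form j l.1 \in B) (enum J)) (tval c)) phi.

(** The first three conditions and the last one turn a realizable set into an assignment; the last
    two turn an assignment into a realizable set. *)
Definition check k (x : kSAT_input r k * certificate) :=
  [&& deterministic x.2.1.1, invertible x.2.1.1, closed_labels x.1.2 x.2.1.1 x.2.1.2,
      witnessed x.1.2 x.2.1.1 x.2.1.2 & closed_window x.1.1 x.2.2].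

Definition states E : seq (word r) := [::] :: [seq e.1.2 | e <- E].

(** With [p] placed at f and [p'] at f a, the entry [push a b] of [p] and the entry [b] of [p']
    stand for the same element of G. *)
Definition compatible B p a p' :=
  all (fun b => ((push a b.1, b.2) \in B) ==>
    (((push a b.1, b.2) \in p) == (b \in p'))) B.

Definition holds_at k (phi : kcnf (word r) k) p j :=
  all (fun c : k.-tuple (word r * bool) =>
    has (fun l => (normal_form j l.1 \in p) (+) l.2) (tval c)) phi.

Definition realizable k (phi : kcnf (word r) k) E N B (Q : seq (word r * window)) :=
  has (fun q => q.1 == [::]) Q &&
  all (fun q =>
    all (fun e => (e.1.1.1 == q.1) ==>
      has (fun q' => (q'.1 == e.1.2) && compatible B q.2 e.1.1.2 q'.2) Q) E &&
    all (fun n => (n.1.1 == q.1) ==> holds_at phi q.2 n.1.2) N) Q.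

Definition answer k (x : kSAT_input r k * certificate) :=
  has (realizable x.1.1 x.2.1.1 x.2.1.2 x.2.2)
    (subseqs [seq (u, p) | u <- states x.2.1.1, p <- subseqs x.2.2]).

(** * Correctness of normal forms *)

Section Correctness.
Variables (G : groupType) (s : r.-tuple G) (gen : X -> G) (T : J -> G).
Local Notation fw := (eval_word gen).
Hypothesis T0 : T j0 = 1.
Hypothesis table_eq : forall j a,
  T j * eval s [:: a] = fw (table (j, a)).1 * T (table (j, a)).2.
Hypothesis fw_inj : forall y j y' j', reduced y -> reduced y' ->
  fw y * T j = fw y' * T j' -> (y, j) = (y', j').
Hypothesis letter_wordE : forall a, eval s (letter_word a) = fw [:: a].
Hypothesis coset_wordE : forall j, eval s (coset_word j) = T j.
Hypothesis eval_surj : forall g, exists w, eval s w = g.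

Lemma fw_push a y : fw (push a y) = fw [:: a] * fw y.
Proof.
case: y => [|b y] /=; first by rewrite eval_word_nil mulg1.
case: eqP => [->|_]; last by rewrite eval_word_cons.
by rewrite [fw (_ :: y)]eval_word_cons eval_word_inv_letter mulVKg.
Qed.

Lemma fw_rev_push a l : fw (rev (push a l)) = fw (rev l) * fw [:: a].
Proof.
case: l => [|b l] /=; first by rewrite eval_word_nil mul1g.
case: eqP => [->|_]; last by rewrite rev_cons eval_word_rcons.
by rewrite rev_cons eval_word_rcons eval_word_inv_letter mulgVK.
Qed.

Lemma fw_rev_foldl c l :
  fw (rev (foldl (fun l x => push x l) l c)) = fw (rev l) * fw c.
Proof.
elim: c l => [|a c IHc] l /=; first by rewrite eval_word_nil mulg1.
by rewrite IHc fw_rev_push [fw (a :: c)]eval_word_cons mulgA.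
Qed.

Lemma reduced_foldl c l : reduced l -> reduced (foldl (fun l (x : X * bool) => push x l) l c).
Proof. by elim: c l => //= a c IHc l rl; apply/IHc/reduced_push. Qed.

Lemma mul_wordE g w :
  fw (rev (mul_word g w).1) * T (mul_word g w).2 = fw (rev g.1) * T g.2 * eval s w.
Proof.
elim: w g => [|a w IHw] g; first by rewrite [eval _ _]eval_word_nil mulg1.
rewrite [LHS]IHw /= fw_rev_foldl -[X in X * _]mulgA -table_eq [eval s (a :: w)]eval_word_cons.
by rewrite !mulgA.
Qed.

Lemma reduced_mul_word g w : reduced g.1 -> reduced (mul_word g w).1.
Proof. by elim: w g => //= a w IHw g rg; apply: IHw; apply: reduced_foldl. Qed.

Lemma normal_formE j w :
  fw (normal_form j w).1 * T (normal_form j w).2 = T j * eval s w.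
Proof. by rewrite mul_wordE eval_word_nil mul1g. Qed.

Lemma reduced_normal_form j w : reduced (normal_form j w).1.
Proof. exact/reduced_rev/reduced_mul_word. Qed.

(** This solves the word problem of G: normal forms are unique by [fw_inj], and [T j0 = 1] makes the
    computation start at the identity. *)
Lemma same_valueP w w' : reflect (eval s w = eval s w') (same_value w w').
Proof.
have E w1 : eval s w1 = fw (normal_form j0 w1).1 * T (normal_form j0 w1).2.
  by rewrite normal_formE T0 mul1g.
apply: (iffP eqP) => [e|]; rewrite E [RHS]E.
  by rewrite /normal_form e.
move/(fw_inj (reduced_normal_form _ _) (reduced_normal_form _ _)).
by case=> /(can_inj revK) e1 e2; apply/eqP; rewrite -pair_eqE /= e1 e2 !eqxx.
Qed.

(** * From a realizable set to an assignment *)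

Section Soundness.
Variables (k : nat) (phi : kcnf (word r) k) (ws : seq (word r)).
Variables (E : seq transition) (N : seq label) (B : window) (Q : seq (word r * window)).
Hypotheses (detE : deterministic E) (invE : invertible E).
Hypotheses (labN : closed_labels ws E N) (winB : closed_window phi B).
Hypothesis realQ : realizable phi E N B Q.

Lemma deltaP u a v :
  reflect (exists2 e, e \in E & e.1 = (u, a, v)) (v \in delta E u a).
Proof.
apply: (iffP mapP) => [[e]|[e Ee eq_e]].
  rewrite mem_filter => /andP[/eqP eq_e Ee] ->; exists e => //.
  by rewrite -eq_e -surjective_pairing.
by exists e; rewrite ?mem_filter ?eq_e ?eqxx.
Qed.

Lemma delta_inj u a v v' : v \in delta E u a -> v' \in delta E u a -> v = v'.
Proof.
case/deltaP=> e Ee eq_e uv'; have /allP := allP detE _ Ee.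
by rewrite eq_e /= => /(_ _ uv')/eqP.
Qed.

Lemma delta_inv u a v : v \in delta E u a -> u \in delta E v (inv_letter a).
Proof. by case/deltaP=> e Ee eq_e; have := allP invE _ Ee; rewrite eq_e. Qed.

(* The state and the pattern reached by reading a reduced word from the base
   state; the word is given last letter first. *)
Fixpoint run (l : seq (X * bool)) : option (word r * window) :=
  if l is a :: l' then
    if run l' is Some q then
      ohead [seq q' <- Q | (q'.1 \in delta E q.1 a) && compatible B q.2 a q'.2]
    else None
  else ohead [seq q <- Q | q.1 == [::]].

Lemma run_mem l q : run l = Some q -> q \in Q.
Proof.
by case: l => [|a l] /=; [|case: (run l) => // q0]; case/ohead_filter.
Qed.

(** Members of [Q] extend along every transition, and determinism forces the state of the extension
    picked by [ohead] to be [v]. *)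
Lemma run_cons l q a v : run l = Some q -> v \in delta E q.1 a ->
  exists2 q', run (a :: l) = Some q' & q'.1 = v /\ compatible B q.2 a q'.2.
Proof.
move=> ql /[dup] uv /deltaP[e Ee eq_e]; rewrite /= ql.
have /andP[/allP/(_ e Ee) + _] : _ := allP (andP realQ).2 _ (run_mem ql).
rewrite eq_e eqxx /= => /hasP[q0 Qq0 /andP[/eqP q0v comp]].
have [|q' eq'] := @ohead_has _
  (fun q' => (q'.1 \in delta E q.1 a) && compatible B q.2 a q'.2) Q.
  by apply/hasP; exists q0 => //; rewrite q0v uv.
exists q' => //; have [/andP[uq' ?] _] := ohead_filter eq'.
by split=> //; apply: delta_inj uq' uv.
Qed.

(** If [a] cancels the top of the stack, the run goes back to the previous pattern. Its
    compatibility with the current one, read in the other direction with the help of [pushK], gives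
    the agreement. *)
Lemma run_push l q a v : reduced l -> run l = Some q -> v \in delta E q.1 a ->
  exists2 q', run (push a l) = Some q' & q'.1 = v /\
    forall y j, reduced y -> (y, j) \in B -> (push a y, j) \in B ->
      ((push a y, j) \in q.2) = ((y, j) \in q'.2).
Proof.
move=> rl ql uv.
have main : exists2 q', run (a :: l) = Some q' & q'.1 = v /\
    forall y j, reduced y -> (y, j) \in B -> (push a y, j) \in B ->
      ((push a y, j) \in q.2) = ((y, j) \in q'.2).
  have [q' q'l [q'v /allP comp]] := run_cons ql uv.
  by exists q' => //; split=> // y j _ By /(implyP (comp _ By))/eqP.
case: l rl ql main => [|b l] //= rl; case: eqP => [->|//].
case ql: (run l) => [q0|] // /ohead_filter[/andP[/delta_inv + /allP comp] _] _.
rewrite inv_letterK => /(delta_inj uv) ->.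
exists q0 => //; split=> // y j ry By Bay.
have := implyP (comp _ Bay); rewrite /= pushK // => /(_ By)/eqP.
by [].
Qed.

(** [reach] follows the letters without cancellation while [run] reads the reduced stack; [run_push]
    reconciles them one letter at a time. *)
Lemma run_reach c us l v : reduced l ->
  (forall u, u \in us -> exists2 q, run l = Some q & q.1 = u) ->
  v \in foldl (fun us a => flatten [seq delta E u a | u <- us]) us c ->
  exists2 q, run (foldl (fun l x => push x l) l c) = Some q & q.1 = v.
Proof.
elim: c us l => [|a c IHc] us l rl us_l /=; first exact: us_l.
apply: IHc; first exact: reduced_push.
move=> u /flattenP[_ /mapP[u0 /us_l[q ql <-] ->] uv].
by have [q' ? [? _]] := run_push rl ql uv; exists q'.
Qed.

(** Induction on the last generator [w]: if h = f T_j, then h w = f (T_j w) = f y T_j', and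
    [closed_labels] makes y readable from the state of f, up to a state labelled j'. *)
Lemma labelled_generated g : generated [set eval s w | w in [set` ws]]%classic g ->
  exists l q j, [/\ reduced l, run l = Some q, labelled N q.1 j & g = fw (rev l) * T j].
Proof.
case/generatedP=> vs + <-; elim/last_ind: vs => [|vs w IHvs] /=.
  have [q qnil] : exists q, run [::] = Some q by apply: ohead_has; case/andP: realQ.
  exists [::], q, j0; split=> //; last by rewrite eval_nil eval_word_nil T0 mulg1.
  by have [/eqP-> _] := ohead_filter qnil; case/andP: labN.
rewrite all_rcons -cats1 flatten_cat eval_cat /= cats0.
case/andP=> ws_w /IHvs[l [q [j [rl ql lab_j ->]]]].
have /mapP[n Nn eq_n] := lab_j.
have /allP/(_ _ ws_w)/hasP[v] := allP (andP labN).2 _ Nn.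
rewrite -eq_n /= => uv lab_v.
have [u|q' q'l q'v] := run_reach rl _ uv; first by rewrite inE => /eqP->; exists q.
exists (foldl (fun l x => push x l) l (normal_form j w).1), q', (normal_form j w).2.
split=> //; [exact: reduced_foldl|by rewrite q'v|].
by rewrite fw_rev_foldl -!mulgA normal_formE.
Qed.

(* The value of f T_j, where f is the product of rev l and y, according to the
   pattern at the longest prefix of rev l that can be read. *)
Fixpoint lookup l y j : bool :=
  if run l is Some q then (y, j) \in q.2
  else if l is a :: l' then lookup l' (a :: y) j else false.

(** The choice of the word is immaterial, because normal forms are unique. *)
Definition word_of g : word r := sval (cid (eval_surj g)).

Definition assignment g :=
  lookup (rev (normal_form j0 (word_of g)).1) [::] (normal_form j0 (word_of g)).2.

Lemma assignmentE l j : reduced l ->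
  assignment (fw (rev l) * T j) = lookup l [::] j.
Proof.
move=> rl; rewrite /assignment; set g := _ * _; set z := normal_form _ _.
have eg : fw z.1 * T z.2 = g.
  by rewrite normal_formE T0 mul1g /word_of; case: cid.
have rz : reduced z.1 by apply: reduced_normal_form.
have := fw_inj rz (reduced_rev rl) eg.
by rewrite -surjective_pairing => ->; rewrite revK.
Qed.

(** Once [l] cannot be read, no longer stack above it can, so the lookup comes down to [l]. *)
Lemma lookup_catrev y l z j : run l = None ->
  lookup (catrev y l) z j = lookup l (y ++ z) j.
Proof.
elim: y l => //= a y IHy l ql.
by rewrite IHy /= ql.
Qed.

(** The patterns agree on overlaps. If the first letter of [y] can be read, pass to the next pattern
    by compatibility; otherwise [l] is the longest readable part of the normal form, and [lookup]
    consults its pattern by definition. *)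
Lemma assignment_run l q y j : reduced l -> run l = Some q -> reduced y ->
  (y, j) \in B -> assignment (fw (rev l) * fw y * T j) = ((y, j) \in q.2).
Proof.
elim: y l q => [|a y IHy] l q rl ql ry By.
  by rewrite eval_word_nil mulg1 assignmentE //; case: l {rl} ql => [|a l] /= ->.
have By' : (y, j) \in B by have := allP (andP winB).1 _ By.
have ry' := reduced_behead ry.
rewrite eval_word_cons mulgA -fw_rev_push.
case uv: (delta E q.1 a) => [|v vs].
  (* If [a] cancelled the last letter read, the inverse of the last transition would allow [a] to be
     read. *)
  have ral : reduced (a :: l).
    case: l rl ql => //= b l -> + /[!andbT]; apply: contra_eqN => /eqP->.
    case: (run l) => // q0; apply/eqP => /ohead_filter[/andP[/delta_inv + _] _].
    by rewrite inv_letterK uv.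
  have nql : run (a :: l) = None by rewrite /= ql uv; elim: (Q).
  rewrite push_reduced //.
  have -> : fw (rev (a :: l)) * fw y = fw (rev (catrev y (a :: l))).
    by rewrite -eval_word_cat catrevE rev_cat revK.
  rewrite assignmentE; last exact: reduced_catrev.
  by rewrite lookup_catrev // cats0 -[lookup _ _ _]/(if run (a :: l) is Some q then _ else _)
    nql; case: (l) ql => [|b l'] /= ->.
have [|q' q'l [_ comp]] := @run_push l q a v rl ql; first by rewrite uv mem_head.
rewrite (IHy _ q') //; last exact: reduced_push.
by rewrite -comp // push_reduced.
Qed.

Lemma realizable_kSAT : kSAT s (phi, ws).
Proof.
exists assignment => g /labelled_generated[l [q [j [rl ql lab_j ->]]]].
rewrite /translate !satisfies_map.
have holds : holds_at phi q.2 j.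
  have /mapP[n Nn eq_n] := lab_j.
  have /andP[_ /allP/(_ n Nn)] := allP (andP realQ).2 _ (run_mem ql).
  by rewrite -eq_n eqxx.
rewrite /map_kcnf all_map; apply/allP => c phi_c /=; rewrite has_map.
have /hasP[x cx holds_x] := allP holds _ phi_c; apply/hasP; exists x => //=.
have Bx : normal_form j x.1 \in B.
  have /allP/(_ _ cx)/allP := allP (andP winB).2 _ phi_c.
  by apply; rewrite mem_enum.
(* The variable h v is f (T_j v), and the normal form of T_j v lies in [B]. *)
rewrite -mulgA -normal_formE mulgA (assignment_run rl ql) //.
exact: reduced_normal_form.
Qed.

End Soundness.

(** * From an assignment to a realizable set *)

Lemma kSAT_realizable k (phi : kcnf (word r) k) ws E N B :
  witnessed ws E N -> closed_window phi B -> kSAT s (phi, ws) ->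
  answer ((phi, ws), (E, N, B)).
Proof.
move=> /andP[witE witN] /andP[_ winB] [alpha alphaP].
(* The restriction of [alpha] to f B, moved back to [B]. The set [Q] consists of all pairs realized
   by some f in the coset of the state. *)
pose pattern f : window := [seq b <- B | alpha (f * (fw b.1 * T b.2))].
pose realized (q : word r * window) :=
  `[< exists2 f, spelled s ws (f * (eval s q.1)^-1) & q.2 = pattern f >].
apply/hasP; exists [seq q <- [seq (u, p) | u <- states E, p <- subseqs B] | realized q] => /=.
  exact: filter_subseqs.
have mem_realized u f : u \in states E -> spelled s ws (f * (eval s u)^-1) ->
    (u, pattern f) \in [seq q <- [seq (u, p) | u <- states E, p <- subseqs B] | realized q].
  move=> Eu uf; rewrite mem_filter allpairs_f ?andbT //; last exact: filter_subseqs.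
  by apply/asboolP; exists f.
apply/andP; split.
  apply/hasP; exists ([::], pattern 1) => //; apply: mem_realized; first by rewrite mem_head.
  by rewrite eval_nil mul1g invg1; apply: spelled1.
apply/allP => -[u p]; rewrite mem_filter => /andP[/asboolP[f /= uf ->] _] {p}.
apply/andP; split.
  apply/allP => e Ee; apply/implyP => /eqP eu.
  have /andP[ws_e /same_valueP] := allP witE e Ee.
  rewrite !eval_cat letter_wordE eu => eq_e.
  apply/hasP; exists (e.1.2, pattern (f * fw [:: e.1.1.2])); last first.
    rewrite eqxx; apply/allP => b Bb; apply/implyP => Bab.
    by rewrite !mem_filter Bb Bab !andbT /= fw_push !mulgA.
  apply: mem_realized; first by rewrite /states inE (map_f (fun e : transition => e.1.2) Ee) orbT.
  (* For a transition with u x = g v, the element f x v^-1 = (f u^-1) g is in [H], so f x realizes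
     the target state. *)
  suff -> : f * fw [:: e.1.1.2] * (eval s e.1.2)^-1 = f * (eval s u)^-1 * eval s (flatten e.2).
    by apply: spelledM => //; exists e.2.
  by apply: (canLR (mulgK _)); rewrite -!mulgA -eq_e mulKg.
apply/allP => n Nn; apply/implyP => /eqP nu.
have /andP[ws_n /same_valueP] := allP witN n Nn.
rewrite eval_cat coset_wordE nu => eq_n.
(* A label u T_j = g puts f T_j in [H], so that the clauses translated by f T_j hold under
   [alpha]. *)
have : generated [set eval s w | w in [set` ws]]%classic (f * T n.1.2).
  apply/generatedP.
  have -> : f * T n.1.2 = f * (eval s u)^-1 * eval s (flatten n.2) by rewrite -eq_n -!mulgA mulKg.
  by apply: spelledM => //; exists n.2.
move/alphaP; rewrite /translate !satisfies_map /map_kcnf all_map => /allP sat.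
apply/allP => c phi_c; have := sat c phi_c; rewrite /= has_map => /hasP[x cx /= sat_x].
apply/hasP; exists x => //; rewrite mem_filter.
have -> : normal_form n.1.2 x.1 \in B.
  have /allP/(_ _ cx)/allP := allP winB _ phi_c.
  by apply; rewrite mem_enum.
by rewrite andbT normal_formE mulgA.
Qed.

Lemma answerP k (x : kSAT_input r k) c :
  check (x, c) -> reflect (kSAT s x) (answer (x, c)).
Proof.
case: x c => [phi ws] [[E N] B]; rewrite /check /=.
case/and5P=> detE invE labN witEN winB; apply: (iffP idP).
  by case/hasP=> Q _; apply: realizable_kSAT.
exact: kSAT_realizable.
Qed.

(** * Existence of a certificate *)

Section Existence.
Variables (k : nat) (phi : kcnf (word r) k) (ws : seq (word r)).
Local Notation spelled := (spelled s ws).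

(* A canonical representative of the right coset of [f] modulo the subgroup
   spelled by [ws]; the subgroup itself is represented by the empty word. *)
Definition rep (f : G) : word r :=
  if `[< spelled f >] then [::]
  else xget [::] [set w | spelled (f * (eval s w)^-1)]%classic.

Lemma rep_spelled f : spelled (f * (eval s (rep f))^-1).
Proof.
rewrite /rep; case: asboolP => [sf|_]; first by rewrite eval_nil invg1 mulg1.
have [w ew] := eval_surj f.
case: xgetP => [_ _ //|/(_ w)[]].
by rewrite /= ew mulgV; apply: spelled1.
Qed.

Lemma rep_eq f g : spelled (f * g^-1) -> rep f = rep g.
Proof.
move=> sfg; have sgf : spelled (g * f^-1) by rewrite -[g]invgK -invgM; apply: spelledV.
have E h : spelled (f * h) <-> spelled (g * h).
  split=> [/(spelledM sgf)|/(spelledM sfg)]; by rewrite mulgA mulgVK.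
rewrite /rep; congr (if _ then _ else xget _ _).
  by apply: asbool_equiv_eq; rewrite -[f]mulg1 -[g]mulg1; apply: E.
by apply/funext => w; apply/propext; apply: E.
Qed.

Definition spelling g : seq (word r) :=
  xget [::] [set vs | all (mem (symmetric_closure ws)) vs /\ eval s (flatten vs) = g]%classic.

Lemma spellingP g : spelled g ->
  all (mem (symmetric_closure ws)) (spelling g) /\ eval s (flatten (spelling g)) = g.
Proof.
by case=> vs ws_vs e; rewrite /spelling; case: xgetP => [_ _ //|/(_ vs)[]].
Qed.

(** The edge of the coset graph leaving H f.1 by the letter f.2. With u and v the representatives of
    its ends, u x v^-1 is in [H] and has a spelling. *)
Definition edge (f : G * (X * bool)) : transition :=
  let f' := f.1 * fw [:: f.2] in
  (rep f.1, f.2, rep f', spelling (eval s (rep f.1) * fw [:: f.2] * (eval s (rep f'))^-1)).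

Fixpoint path_edges f (c : seq (X * bool)) :=
  if c is a :: c' then (f, a) :: path_edges (f * fw [:: a]) c' else [::].

Definition opposite_edge (f : G * (X * bool)) := (f.1 * fw [:: f.2], inv_letter f.2).

(** The finitely many paths read by [closed_labels]: as T_j w = y T_j', the path of y from H T_j^-1
    ends at H T_j'^-1 when w is in [H]. *)
Definition forward_edges := flatten
  [seq path_edges (T j)^-1 (normal_form j w).1 | j <- enum J, w <- symmetric_closure ws].

Definition edges := forward_edges ++ [seq opposite_edge f | f <- forward_edges].

Definition core_transitions := [seq edge f | f <- edges].

Definition core_labels : seq label :=
  [seq (rep (T j)^-1, j, spelling (eval s (rep (T j)^-1) * T j)) | j <- enum J].

Definition core_window : window :=
  flatten [seq flatten [seq flatten [seq
    [seq (drop i (normal_form j l.1).1, (normal_form j l.1).2)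
      | i <- iota 0 (size (normal_form j l.1).1).+1] | j <- enum J]
    | l <- tval c] | c <- phi].

Lemma opposite_edge_mem f : f \in edges -> opposite_edge f \in edges.
Proof.
rewrite !mem_cat => /orP[Ef|/mapP[[g a] Eg ->]]; first by rewrite map_f ?orbT.
suff -> : opposite_edge (opposite_edge (g, a)) = (g, a) by rewrite Eg.
by rewrite /opposite_edge /= inv_letterK eval_word_inv_letter mulgK.
Qed.

Lemma core_deltaP u a v :
  v \in delta core_transitions u a <->
  exists2 f, (f, a) \in edges & u = rep f /\ v = rep (f * fw [:: a]).
Proof.
split=> [/deltaP[_ /mapP[[f b] Ef ->]] [<- eb <-]|[f Ef [-> ->]]].
  by exists f; rewrite -?eb.
by apply/deltaP; exists (edge (f, a)) => //; apply: map_f.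
Qed.

(** G acts by right multiplication on the right cosets of [H]; determinism of the core follows. *)
Lemma rep_mulr f g h : rep f = rep g -> rep (f * h) = rep (g * h).
Proof.
move=> efg; apply: rep_eq; rewrite invgM mulgA mulgK.
have := spelledM (rep_spelled f) (spelledV (rep_spelled g)).
by rewrite efg invgM invgK mulgA mulgVK.
Qed.

Lemma core_deterministic : deterministic core_transitions.
Proof.
apply/allP => _ /mapP[[f a] _ ->]; apply/allP => v /core_deltaP[g _ [efg ->]] /=.
by apply/eqP/rep_mulr.
Qed.

Lemma core_invertible : invertible core_transitions.
Proof.
apply/allP => _ /mapP[[f a] Ef ->] /=; apply/core_deltaP.
exists (f * fw [:: a]); first exact: (opposite_edge_mem Ef).
by rewrite eval_word_inv_letter mulgK.
Qed.

Lemma core_reach c f us : rep f \in us -> {subset path_edges f c <= edges} ->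
  rep (f * fw c) \in foldl (fun us a =>
    flatten [seq delta core_transitions u a | u <- us]) us c.
Proof.
elim: c f us => [|a c IHc] f us us_f sub /=; first by rewrite eval_word_nil mulg1.
rewrite eval_word_cons mulgA; apply: IHc => [|g cg]; last by apply: sub; rewrite inE cg orbT.
apply/flattenP; exists (delta core_transitions (rep f) a); first exact: map_f.
by apply/core_deltaP; exists f => //; apply: sub; rewrite inE eqxx.
Qed.

Lemma core_closed_labels : closed_labels ws core_transitions core_labels.
Proof.
have lab j : labelled core_labels (rep (T j)^-1) j.
  rewrite /labelled -map_comp; apply/mapP; exists j => //.
  by rewrite mem_enum.
apply/andP; split.
  by have := lab j0; rewrite T0 invg1 /rep (asboolT (spelled1 s ws)).
apply/allP => _ /mapP[j _ ->]; apply/allP => w ws_w /=; apply/hasP.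
exists (rep (T (normal_form j w).2)^-1); last exact: lab.
suff <- : rep ((T j)^-1 * fw (normal_form j w).1) = rep (T (normal_form j w).2)^-1.
  apply: core_reach => [|f wf]; first by rewrite mem_head.
  rewrite mem_cat; apply/orP; left; apply/flattenP.
  exists (path_edges (T j)^-1 (normal_form j w).1) => //.
  by apply: allpairs_f => //; rewrite mem_enum.
(* The quotient of the two elements is T_j^-1 y T_j', that is [w]. *)
apply: rep_eq; rewrite invgK -mulgA normal_formE mulKg.
by exists [:: w]; rewrite /= ?cats0 // andbT.
Qed.

Lemma core_witnessed : witnessed ws core_transitions core_labels.
Proof.
apply/andP; split; apply/allP.
  move=> _ /mapP[[f a] _ ->] /=; set f' := f * _; set g := _ * _.
  have [|ws_g eg] := @spellingP g.
    have := spelledM (spelledV (rep_spelled f)) (rep_spelled f').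
    by rewrite /f' invgM invgK !mulgA mulgVK.
  apply/andP; split=> //; apply/same_valueP.
  by rewrite !eval_cat letter_wordE eg /g mulgVK.
move=> _ /mapP[j _ ->] /=; set g := _ * _.
have [|ws_g eg] := @spellingP g.
  have := spelledV (rep_spelled (T j)^-1).
  by rewrite invgM !invgK.
apply/andP; split=> //; apply/same_valueP.
by rewrite eval_cat coset_wordE eg.
Qed.

Lemma core_windowE : closed_window phi core_window.
Proof.
apply/andP; split; apply/allP.
  move=> b /flattenP[_ /mapP[c phi_c ->]] /flattenP[_ /mapP[l cl ->]].
  case/flattenP=> _ /mapP[j Jj ->] /mapP[i]; rewrite mem_iota /= add0n ltnS => le_i ->.
  case e: (drop _ _) => [|a y] //=; apply/flattenP.
  eexists; first by apply: map_f phi_c.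
  apply/flattenP; eexists; first by apply: map_f cl.
  apply/flattenP; eexists; first by apply: map_f Jj.
  (* The suffix at [i] is nonempty, so [i] is below the size and [i.+1] is still in the range, which
     includes the empty suffix. *)
  apply/mapP; exists i.+1; last by rewrite -[i.+1]addn1 addnC -drop_drop e /= drop0.
  rewrite mem_iota /= add0n !ltnS ltn_neqAle le_i andbT.
  by apply: contra_eqN e => /eqP->; rewrite drop_size.
move=> c phi_c; apply/allP => l cl; apply/allP => j Jj.
apply/flattenP; eexists; first by apply: map_f phi_c.
apply/flattenP; eexists; first by apply: map_f cl.
apply/flattenP; eexists; first by apply: map_f Jj.
by apply/mapP; exists 0%N; rewrite ?drop0 -?surjective_pairing // mem_iota.
Qed.

End Existence.

Lemma check_exists k (x : kSAT_input r k) : exists c, check (x, c).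
Proof.
case: x => phi ws; exists (core_transitions ws, core_labels ws, core_window phi).
apply/and5P; split.
- exact: core_deterministic.
- exact: core_invertible.
- exact: core_closed_labels.
- exact: core_witnessed.
- exact: core_windowE.
Qed.

End Correctness.

(** * Computability of the checker and of the answer *)

Lemma computable_inv_letter (A : countType) (f : A -> X * bool) :
  computable f -> computable (fun a => inv_letter (f a)).
Proof. by move=> cf; rewrite /inv_letter; computability; computable_list_step; computability. Qed.

Lemma computable_push (A : countType) (f : A -> X * bool) (g : A -> seq (X * bool)) :
  computable f -> computable g -> computable (fun a => push (f a) (g a)).
Proof.
move=> cf cg; rewrite /push; computability.
by apply: computable_inv_letter; computability.
Qed.

Lemma computable_mul_gen (A : countType) (f : A -> seq (X * bool) * J) (g : A -> 'I_r * bool) :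
  computable f -> computable g -> computable (fun a => mul_gen (f a) (g a)).
Proof.
move=> cf cg; have ct : computable table by apply: computable_finite.
rewrite /mul_gen; computability; computable_list_step; computability.
by apply: computable_push; computability.
Qed.

Lemma computable_mul_word (A : countType) (f : A -> seq (X * bool) * J) (g : A -> word r) :
  computable f -> computable g -> computable (fun a => mul_word (f a) (g a)).
Proof.
by move=> cf cg; apply: computable_foldl => //; apply: computable_mul_gen; computability.
Qed.

Lemma computable_normal_form (A : countType) (f : A -> J) (g : A -> word r) :
  computable f -> computable g -> computable (fun a => normal_form (f a) (g a)).
Proof.
move=> cf cg; rewrite /normal_form; computability; [computable_list_step; computability|];
  by apply: computable_mul_word; computability.
Qed.

Lemma computable_same_value (A : countType) (f g : A -> word r) :
  computable f -> computable g -> computable (fun a => same_value (f a) (g a)).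
Proof.
by move=> cf cg; apply: computable_eq; apply: computable_mul_word; computability.
Qed.

Lemma computable_symmetric_closure (A : countType) (f : A -> seq (word r)) :
  computable f -> computable (fun a => symmetric_closure (f a)).
Proof.
move=> cf; rewrite /symmetric_closure /inv_word /inv_letter.
by do ?[computable_step | computable_list_step].
Qed.

Lemma computable_delta (A : countType) (f : A -> seq transition) (g : A -> word r)
    (h : A -> X * bool) :
  computable f -> computable g -> computable h ->
  computable (fun a => delta (f a) (g a) (h a)).
Proof. by move=> cf cg ch; rewrite /delta; do ?[computable_step | computable_list_step]. Qed.

Lemma computable_labelled (A : countType) (f : A -> seq label) (g : A -> word r) (h : A -> J) :
  computable f -> computable g -> computable h ->
  computable (fun a => labelled (f a) (g a) (h a)).
Proof. by move=> cf cg ch; rewrite /labelled; do ?[computable_step | computable_list_step]. Qed.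

Ltac algorithm_step :=
  match goal with
  | |- computable (fun x => inv_letter _) => apply: computable_inv_letter
  | |- computable (fun x => push _ _) => apply: computable_push
  | |- computable (fun x => normal_form _ _) => apply: computable_normal_form
  | |- computable (fun x => same_value _ _) => apply: computable_same_value
  | |- computable (fun x => symmetric_closure _) => apply: computable_symmetric_closure
  | |- computable (fun x => delta _ _ _) => apply: computable_delta
  | |- computable (fun x => labelled _ _ _) => apply: computable_labelled
  end.

Ltac algorithm := do ?[computable_step | computable_list_step | algorithm_step].

Lemma computable_check k : computable (@check k).
Proof.
have cl : computable letter_word by apply: computable_finite.
have cc : computable coset_word by apply: computable_finite.
rewrite /check /deterministic /invertible /closed_labels /witnessed /closed_window /reach.
by algorithm.
Qed.

Lemma computable_answer k : computable (@answer k).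
Proof.
by rewrite /answer /realizable /states /compatible /holds_at; algorithm.
Qed.

Lemma decidable_kSAT (G : groupType) (s : r.-tuple G) (gen : X -> G) (T : J -> G) k :
  T j0 = 1 ->
  (forall j a, T j * eval s [:: a] = eval_word gen (table (j, a)).1 * T (table (j, a)).2) ->
  (forall y j y' j', reduced y -> reduced y' ->
     eval_word gen y * T j = eval_word gen y' * T j' -> (y, j) = (y', j')) ->
  (forall a, eval s (letter_word a) = eval_word gen [:: a]) ->
  (forall j, eval s (coset_word j) = T j) ->
  (forall g, exists w, eval s w = g) ->
  decidable_problem (@kSAT G r s k).
Proof.
move=> T0 table_eq fw_inj letter_wordE coset_wordE eval_surj.
have dw : decodable (word r) by apply/decodable_seq/decodable_finite.
have dX : decodable (X * bool)%type by apply: decodable_finite.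
have dJ : decodable J by apply: decodable_finite.
have db : decodable bool by apply: decodable_finite.
apply: (@decidable_search _ _ (@check k) (@answer k)).
- apply: decodable_pair; last exact: decodable_seq.
  by apply/decodable_seq/decodable_tuple/decodable_pair.
- apply: decodable_pair; [apply: decodable_pair|]; apply: decodable_seq.
  + by do 3?[apply: decodable_pair => //]; apply: decodable_seq.
  + by do 2?[apply: decodable_pair => //]; apply: decodable_seq.
  + by apply: decodable_pair => //; apply: decodable_seq.
- exact: computable_check.
- exact: computable_answer.
- exact: (check_exists T0 table_eq).
- exact: (answerP T0 table_eq).
Qed.

End Algorithm.

(** * Normal forms in a finitely generated virtually free group *)

Theorem corollary26 (G : groupType) (infG : infinite_set [set: G]%classic)
    (fgG : finitely_generated G) (vfG : virtually_free G)
    (k : nat) (k_gt1 : (1 < k)%N) :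
  kSAT_decidable G k.
Proof.
move=> r s gen_s; have surj := eval_word_surj gen_s.
have [H [subH finH [Y [phi [phi_inj rangeH]]]]] := vfG.
have [J [j0 [T [T0 cover uniqT]]]] := right_transversal subH finH.
have Hphi u : H (phi u) by rewrite -rangeH; exists u.
have step (x : J * ('I_r * bool)) : exists z : free_group Y * J,
    T x.1 * eval s [:: x.2] = phi z.1 * T z.2.
  have [h + [j ->]] := cover (T x.1 * eval s [:: x.2]).
  by rewrite -rangeH => -[u _ <-]; exists (u, j).
have [step_of stepE] := choice step.
(* The basis [Y] may be infinite, but only the letters of these finitely many words occur in
   computations; they form the finite alphabet [X]. *)
pose letters : seq Y :=
  flatten [seq [seq a.1 | a <- free_word (step_of x).1] | x : J * ('I_r * bool)].
pose X := seq_sub letters.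
pose incl (a : X * bool) : Y * bool := (ssval a.1, a.2).
have incl_inj : injective incl by move=> [x b] [y c] [/val_inj-> ->].
have lift (x : J * ('I_r * bool)) : exists z : seq (X * bool) * J,
    map incl z.1 = (step_of x).1 /\ z.2 = (step_of x).2.
  suff [w ew] : exists w, map incl w = (step_of x).1 by exists (w, (step_of x).2).
  have : {subset [seq a.1 | a <- free_word (step_of x).1] <= letters}.
    move=> y uy; apply/flattenP; exists [seq a.1 | a <- free_word (step_of x).1] => //.
    by apply: map_f; rewrite mem_enum.
  elim: (free_word _) => [|[y b] w IHw] sub; first by exists [::].
  have [|v <-] := IHw; first by move=> z wz; apply: sub; rewrite inE wz orbT.
  have yl : y \in letters by apply: sub; rewrite mem_head.
  by exists ((SeqSub yl, b) :: v).
have [table tableE] := choice lift.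
pose gen (x : X) : G := phi (@FreeGroup Y [:: (ssval x, false)] isT).
have genE y : eval_word gen y =
    eval_word (fun z => phi (@FreeGroup Y [:: (z, false)] isT)) (map incl y).
  by rewrite /eval_word big_map.
have reduced_incl y : reduced y -> reduced (map incl y).
  rewrite /reduced sorted_map; apply: sub_sorted => a b /=.
  by apply: contraNneq => e; apply/eqP/incl_inj; rewrite e.
(* Since [s] generates G, the letters of [X] and the transversal have spellings in [s], which allow
   transitions and labels to be checked as equalities of words. *)
have [letter_word letter_wordE] := choice (fun a : X * bool => surj (eval_word gen [:: a])).
have [coset_word coset_wordE] := choice (fun j => surj (T j)).
apply: (decidable_kSAT (table := table) k T0 _ _ letter_wordE coset_wordE surj)
  => [j a|y j y' j' ry ry'].
  by rewrite (stepE (j, a)) eval_free_word genE; have [-> ->] := tableE (j, a).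
rewrite !genE -[map incl y]/(free_word (FreeGroup (reduced_incl _ ry))).
rewrite -[map incl y']/(free_word (FreeGroup (reduced_incl _ ry'))) -!eval_free_word => e.
(* The transversal determines [j]; then injectivity of [phi] and of [incl] determines the reduced
   word. *)
have ej : j = j' by apply: uniqT e.
move: e; rewrite -ej => /mulIg/phi_inj[/(inj_map incl_inj) ->].
by [].
Qed.
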